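(* (i) $\mathbf{Sem}(S_{\mathrm{I}^{\mathrm{sol}}}^{\mathbf{s}})=\mathbf{Sem}(S_{\mathrm{Abel}}^{\mathbf{s}})$, and a Banach Lie algebra $\mathcal{L}$ belongs to them if and only if $\mathcal{L}$ has no non-zero commutative finite-dimensional Lie subideals. (ii) The map $K:\mathcal{L}\mapsto K(\mathcal{L})=\mathrm{Centre}(\mathcal{L})$, for each Banach Lie algebra $\mathcal{L}$, is a lower stable preradical and $$(S_{\mathrm{I}^{\mathrm{sol}}}^{\mathbf{s}})^{\ast}=(S_{\mathrm{Abel}}^{\mathbf{s}})^{\ast}=(K^{\mathbf{s}})^{\ast}.$$ (iii) The restriction of $(S_{\mathrm{Abel}}^{\mathbf{s}})^{\ast}$ to the finite-dimensional Lie algebras is $\mathrm{rad}$, that is, $(S_{\mathrm{Abel}}^{\mathbf{s}})^{\ast}(\mathcal{L})=\mathrm{rad}(\mathcal{L})$ for every finite-dimensional complex Lie algebra $\mathcal{L}$.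
   Context: A Banach Lie algebra is a complex Lie algebra $\mathcal{L}$ which is a Banach space in some norm such that, for some constant $t_{\mathcal{L}}>0$, $\|[a,b]\|\leq t_{\mathcal{L}}\|a\|\|b\|$ for all $a,b\in\mathcal{L}$. Finite-dimensional complex Lie algebras (with any norm) are Banach Lie algebras. A preradical is a map $R$ that sends each Banach Lie algebra $\mathcal{L}$ to a closed Lie ideal $R(\mathcal{L})$ such that $f(R(\mathcal{L}))\subseteq R(\mathcal{M})$ for each bounded Lie homomorphism $f:\mathcal{L}\to\mathcal{M}$ with dense image. It is lower stable if $R(R(\mathcal{L}))=R(\mathcal{L})$ for all $\mathcal{L}$. $\mathbf{Sem}(R)=\{\mathcal{L}:R(\mathcal{L})=\{0\}\}$. $S_{\mathrm{I}^{\mathrm{sol}}}(\mathcal{L})$ is the closed linear span of all finite-dimensional solvable Lie ideals of $\mathcal{L}$; $S_{\mathrm{Abel}}(\mathcal{L})$ is the closed linear span of all (closed) commutative Lie ideals of $\mathcal{L}$. These are lower stable preradicals. A Lie subalgebra $I$ of $\mathcal{L}$ is a Lie subideal if there are Lie subalgebras $I=J_{0}\subseteq J_{1}\subseteq\cdots\subseteq J_{n}=\mathcal{L}$ with each $J_{i}$ a Lie ideal of $J_{i+1}$. For a preradical $R$, $R^{\mathbf{s}}(\mathcal{L})$ is the closed linear span of all closed Lie subideals $I$ of $\mathcal{L}$ with $R(I)=I$; $R^{\mathbf{s}}$ is again a preradical. For a preradical $R$ put $R^{(0)}(\mathcal{L})=\{0\}$, $R^{(\alpha+1)}(\mathcal{L})=q_{\alpha}^{-1}\big(R(\mathcal{L}/R^{(\alpha)}(\mathcal{L}))\big)$,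 where $q_{\alpha}:\mathcal{L}\to\mathcal{L}/R^{(\alpha)}(\mathcal{L})$ is the quotient map, and $R^{(\alpha)}(\mathcal{L})=\overline{\bigcup_{\alpha'<\alpha}R^{(\alpha')}(\mathcal{L})}$ for limit ordinals $\alpha$; this increasing transfinite chain of closed ideals stabilizes and $R^{\ast}(\mathcal{L})$ is its stable value. $\mathrm{rad}(\mathcal{L})$ is the maximal solvable Lie ideal of a finite-dimensional Lie algebra $\mathcal{L}$. *)

(* Defs.v *)
From HB Require Import structures.
From mathcomp Require Import all_boot all_order all_algebra.
From mathcomp Require Import generic_quotient ring_quotient complex.
From mathcomp Require Import ring.
From mathcomp Require wochoice.
From mathcomp Require Import all_classical reals topology normedtype sequences.

Set Implicit Arguments.
Unset Strict Implicit.
Unset Printing Implicit Defensive.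

Import Order.TTheory GRing.Theory Num.Theory.
Import numFieldNormedType.Exports.

Local Open Scope classical_set_scope.
Local Open Scope ring_scope.
Local Open Scope complex_scope.

(* Norms of a [CompleteNormedModule R[i]] take their values in [R[i]], where
   [0 < t] entails that [t] is real. *)
HB.mixin Record isBanachLie (R : realType) (L : Type)
    & CompleteNormedModule R[i] L := {
  lie : L -> L -> L;
  lie_linearl : forall y, linear (fun x => lie x y);
  lie_linearr : forall x, linear (lie x);
  liexx : forall x, lie x x = 0;
  lie_jacobi : forall x y z,
    lie x (lie y z) + lie y (lie z x) + lie z (lie x y) = 0;
  lie_bounded : exists2 t : R[i], 0 < t &
    forall x y, `|lie x y| <= t * `|x| * `|y|
}.

#[short(type="banachLieType")]
HB.structure Definition BanachLie (R : realType) :=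
  {L of CompleteNormedModule R[i] L & isBanachLie R L}.

Section LieSets.
Variables (R : realType) (L : banachLieType R).
Implicit Types (A B I J : set L).

Definition subspace_set A := submod_closed (mem A).

Definition lspan A : set L := smallest subspace_set A.

Definition cspan A : set L := closure (lspan A).

Definition finite_dim A := exists s : seq L, A `<=` lspan [set` s].

Definition lie_subalgebra A :=
  subspace_set A /\ forall x y, A x -> A y -> A (lie x y).

Definition lie_ideal_of I J :=
  [/\ subspace_set I, I `<=` J & forall x y, J x -> I y -> I (lie x y)].

Definition lie_ideal I := lie_ideal_of I setT.

Definition lie_subideal I := exists (n : nat) (J : nat -> set L),
  [/\ J 0%N = I, J n = setT, forall i, (i <= n)%N -> lie_subalgebra (J i)
    & forall i, (i < n)%N -> lie_ideal_of (J i) (J i.+1)].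

Definition commutative_set A := forall x y, A x -> A y -> lie x y = 0.

Definition derived A : set L :=
  lspan [set z | exists x y, [/\ A x, A y & z = lie x y]].

Definition solvable_set A := exists n : nat, iter n derived A `<=` [set 0].

(* "Maximal" is read as "largest": in finite dimension the maximal solvable
   ideal contains all the others. *)
Definition is_radical J :=
  [/\ lie_ideal J, solvable_set J &
      forall I, lie_ideal I -> solvable_set I -> I `<=` J].

Record closed_subalgebra := ClosedSubalgebra {
  subalgebra_set :> set L;
  subalgebra_closed : closed subalgebra_set;
  subalgebraP : lie_subalgebra subalgebra_set
}.

Record closed_ideal := ClosedIdeal {
  ideal_set :> set L;
  ideal_closed : closed ideal_set;
  idealP : lie_ideal ideal_set
}.

End LieSets.

Section BanachLieTheory.
Variables (R : realType) (L : banachLieType R).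

Lemma lie0r (x : L) : lie x 0 = 0.
Proof. by have := lie_linearr x (-1) 0 0; rewrite scaler0 addr0 scaleN1r addNr. Qed.

Lemma lie0l (x : L) : lie 0 x = 0.
Proof. by have := lie_linearl x (-1) 0 0; rewrite scaler0 addr0 scaleN1r addNr. Qed.

Lemma lieDl (x y z : L) : lie (x + y) z = lie x z + lie y z.
Proof. by have := lie_linearl z 1 x y; rewrite !scale1r. Qed.

Lemma lieDr (x y z : L) : lie z (x + y) = lie z x + lie z y.
Proof. by have := lie_linearr z 1 x y; rewrite !scale1r. Qed.

Lemma lieNr (x z : L) : lie z (- x) = - lie z x.
Proof. by have := lie_linearr z (-1) x 0; rewrite lie0r !addr0 !scaleN1r. Qed.

Lemma lieNl (x z : L) : lie (- x) z = - lie x z.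
Proof. by have := lie_linearl z (-1) x 0; rewrite lie0l !addr0 !scaleN1r. Qed.

Lemma lieC (x y : L) : lie x y = - lie y x.
Proof.
apply/eqP; rewrite -addr_eq0; apply/eqP.
by have := liexx (x + y); rewrite lieDl !lieDr !liexx add0r addr0.
Qed.

End BanachLieTheory.


Section Completeness.
Variable R : realType.

Lemma half_expn_lt (e : R[i]) : 0 < e -> exists n, (2^-1 : R[i]) ^+ n < e.
Proof.
case: e => a b; rewrite ltcE /= => /andP[/eqP -> a0].
exists (Num.bound a^-1); set n := Num.bound a^-1.
have -> : (2^-1 : R[i]) ^+ n = ((2^-1 : R) ^+ n)%:C.
  by rewrite rmorphXn fmorphV rmorph_nat.
rewrite -[X in _ < X]/(a%:C) ltcR exprVn invf_plt ?posrE ?exprn_gt0//.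
apply: lt_trans (archi_boundP _) _; first by rewrite invr_ge0 ltW.
by rewrite -natrX ltr_nat ltn_expl.
Qed.

Let half_gt0 n : 0 < (2^-1 : R[i]) ^+ n.
Proof. by rewrite exprn_gt0// invr_gt0. Qed.

Definition fast_cauchy (V : normedModType R[i]) (y : nat -> V) :=
  forall n, `|y n.+1 - y n| < 2^-1 ^+ n.

Lemma fast_cauchy_complete (V : normedModType R[i]) :
  (forall y : nat -> V, fast_cauchy y -> exists l : V, y @ \oo --> l) ->
  forall F : set_system V, ProperFilter F -> cauchy F -> cvg F.
Proof.
move=> cV F FF /cauchyP Fc.
have /choice[y Fy] n : exists x, F (ball x ((2^-1 : R[i]) ^+ n / 2)).
  by apply: Fc; rewrite divr_gt0.
have [|l yl] := cV y.
  move=> n; have [z [/=]] := filter_ex (filterI (Fy n) (Fy n.+1)).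
  rewrite -!ball_normE /= => yz y1z.
  rewrite (distm_lt_split (z := z))//; last by rewrite distrC.
  apply: lt_trans y1z _; rewrite ltr_pM2r ?invr_gt0//.
  by rewrite exprS gtr_pMl// invf_lt1// ltr1n.
apply/cvg_ex; exists l; apply/fcvgrPdist_lt => e e0.
have e2 : 0 < e / 2 by rewrite divr_gt0.
have [N hN] := half_expn_lt e2.
have /cvgrPdist_lt/(_ _ e2)[M _ hM] := yl.
have hn : (2^-1 : R[i]) ^+ maxn N M < e / 2.
  apply: le_lt_trans hN; rewrite ler_wiXn2l ?leq_maxl//.
    by rewrite invr_ge0.
  by rewrite invf_le1// ler1n.
apply: filterS (Fy (maxn N M)) => z; rewrite -ball_normE/= => yz.
apply: (distm_lt_split (z := y (maxn N M))).
  by apply: hM; rewrite /= leq_maxr.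
apply: lt_trans yz (lt_trans _ hn).
by rewrite gtr_pMr// invf_lt1// ltr1n.
Qed.

Lemma fast_cauchy_cvg (V : completeNormedModType R[i]) (y : nat -> V) :
  fast_cauchy y -> exists l : V, y @ \oo --> l.
Proof.
move=> hy; apply/cvg_ex; apply: cauchy_cvg; apply: (@cauchy_exP R[i]) => e e0.
have e2 : 0 < e / 2 by rewrite divr_gt0.
have [N hN] := half_expn_lt e2.
have dist k : `|y (N + k)%N - y N| <= 2 * (2^-1 ^+ N - 2^-1 ^+ (N + k)).
  elim: k => [|k IHk]; first by rewrite addn0 !subrr normr0 mulr0.
  rewrite -(subrKA (y (N + k)%N)) (le_trans (ler_normD _ _))//.
  rewrite addnS (le_trans (lerD (ltW (hy _)) IHk))// exprS.
  set h := 2^-1 ^+ (N + k); set a := 2^-1 ^+ N.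
  by rewrite [leLHS](_ : _ = 2 * (a - 2^-1 * h))//; field.
exists (y N), N => // n /= Nn; rewrite -ball_normE/= distrC.
rewrite -(subnKC Nn) (le_lt_trans (dist _))//.
rewrite -ltr_pdivlMl// mulrC (le_lt_trans _ hN)// gerBl.
exact: ltW.
Qed.

End Completeness.

Section SubBanachLie.
Variables (R : realType) (L : banachLieType R) (S : closed_subalgebra L).

Definition subalgebra_pred : pred L := fun x => x \in subalgebra_set S.

Let submodS : submod_closed subalgebra_pred.
Proof. by have [] := subalgebraP S. Qed.

HB.instance Definition _ :=
  GRing.isSubmodClosed.Build R[i] L subalgebra_pred submodS.

Definition subalgebra_type : Type := {x : L | subalgebra_pred x}.

HB.instance Definition _ := SubChoice.on subalgebra_type.
HB.instance Definition _ :=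
  [SubChoice_isSubLmodule of subalgebra_type by <:].

Local Notation T := subalgebra_type.

Let norm_eq0 (u : T) : `|val u| = 0 -> u = 0.
Proof. by move/normr0_eq0 => u0; apply: val_inj; rewrite u0 raddf0. Qed.

HB.instance Definition _ := @Lmodule_isNormed.Build R[i] T
  (fun u => `|val u|) (fun _ _ => ler_normD _ _) (fun _ _ => normrZ _ _)
  norm_eq0.

Lemma subalgebra_val (u : T) : subalgebra_set S (val u).
Proof. by have := valP u; rewrite /subalgebra_pred inE. Qed.

Let complete (F : set_system T) : ProperFilter F -> cauchy F -> cvg F.
Proof.
apply: fast_cauchy_complete => y hy.
have [l yl] := @fast_cauchy_cvg R L (fun n => val (y n)) hy.
have Sl : subalgebra_set S l.
  apply: (closed_cvg (subalgebra_set S)) yl; first exact: subalgebra_closed.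
  by apply: nearW => n; exact: subalgebra_val.
exists (exist _ l (mem_set Sl)); apply/cvgrPdist_lt => e e0.
by move/cvgrPdist_lt : yl => /(_ e e0).
Qed.

HB.instance Definition _ := Uniform_isComplete.Build T complete.

Let lie_sub (u v : T) : subalgebra_pred (lie (val u) (val v)).
Proof.
apply/mem_set; have [_] := subalgebraP S; apply; exact: subalgebra_val.
Qed.

Definition sub_lie (u v : T) : T := exist _ (lie (val u) (val v)) (lie_sub u v).

Let sub_linearl v : linear (fun u => sub_lie u v).
Proof. by move=> a x y; apply: val_inj; exact: lie_linearl. Qed.

Let sub_linearr v : linear (sub_lie v).
Proof. by move=> a x y; apply: val_inj; exact: lie_linearr. Qed.

Let sub_liexx x : sub_lie x x = 0.
Proof. by apply: val_inj; exact: liexx. Qed.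

Let sub_jacobi x y z :
  sub_lie x (sub_lie y z) + sub_lie y (sub_lie z x) + sub_lie z (sub_lie x y)
  = 0.
Proof. by apply: val_inj; exact: lie_jacobi. Qed.

Let sub_bounded : exists2 t : R[i], 0 < t &
  forall x y, `|sub_lie x y| <= t * `|x| * `|y|.
Proof.
by have [t t0 ht] := @lie_bounded R L; exists t => // x y; exact: ht.
Qed.

HB.instance Definition _ := isBanachLie.Build R T
  sub_linearl sub_linearr sub_liexx sub_jacobi sub_bounded.

End SubBanachLie.

Section QuotientBanachLie.
Variables (R : realType) (L : banachLieType R) (I : closed_ideal L).

Definition ideal_pred : pred L := fun x => x \in ideal_set I.

Let submodI : submod_closed ideal_pred.
Proof. by have [] := idealP I. Qed.

HB.instance Definition _ :=
  GRing.isSubmodClosed.Build R[i] L ideal_pred submodI.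

Local Notation Q := (Quotient.quot (GRing.ZmodClosed.clone L ideal_pred _)).

Definition quotient_type : Type := Q.
Local Notation T := quotient_type.

HB.instance Definition _ := GRing.Zmodule.copy T Q.

Definition quotient_map (x : L) : T := (\pi_Q x)%qT.
Local Notation q := quotient_map.

Lemma quotient_mapP x y : q x = q y <-> ideal_set I (x - y).
Proof.
split=> [xy|Ixy].
  apply: set_mem; rewrite -[_ \in _]/(_ \in ideal_pred).
  by rewrite Quotient.idealrBE; exact/eqP.
apply/eqP; rewrite -Quotient.idealrBE; exact/mem_set.
Qed.

Lemma quotient_mapD x y : q (x + y) = q x + q y.
Proof. exact: Quotient.pi_add. Qed.

Lemma quotient_mapN x : q (- x) = - q x.
Proof. exact: Quotient.pi_opp. Qed.

Definition quotient_repr (u : T) : L := repr (u : Q).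

Lemma quotient_reprK u : q (quotient_repr u) = u.
Proof. exact: reprK. Qed.

Let idealZ a x : ideal_set I x -> ideal_set I (a *: x).
Proof.
move=> /mem_set Ix; apply: set_mem; have [I0 Il] := submodI.
by have := Il a x 0 Ix I0; rewrite addr0.
Qed.

Let idealD x y : ideal_set I x -> ideal_set I y -> ideal_set I (x + y).
Proof.
move=> /mem_set Ix /mem_set Iy; apply: set_mem.
by have [_ /(_ 1 x y Ix Iy)] := submodI; rewrite scale1r.
Qed.

Let ideal_liel x y : ideal_set I y -> ideal_set I (lie x y).
Proof. by have [_ _] := idealP I; apply. Qed.

Let ideal_lier x y : ideal_set I x -> ideal_set I (lie x y).
Proof.
move=> Ix; rewrite lieC -scaleN1r; apply: idealZ; exact: ideal_liel.
Qed.

Definition quotient_scale (a : R[i]) (u : T) : T := q (a *: quotient_repr u).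

Let scaleE a x : quotient_scale a (q x) = q (a *: x).
Proof.
apply/quotient_mapP; rewrite -scalerBr; apply: idealZ.
by apply/quotient_mapP; rewrite quotient_reprK.
Qed.

Let scaleA a b u :
  quotient_scale a (quotient_scale b u) = quotient_scale (a * b) u.
Proof. by rewrite -(quotient_reprK u) !scaleE scalerA. Qed.

Let scale1 : left_id 1 quotient_scale.
Proof. by move=> u; rewrite -(quotient_reprK u) scaleE scale1r. Qed.

Let scaleDr : right_distributive quotient_scale +%R.
Proof.
move=> a u v; rewrite -(quotient_reprK u) -(quotient_reprK v).
by rewrite -quotient_mapD !scaleE scalerDr quotient_mapD.
Qed.

Let scaleDl u : {morph quotient_scale^~ u : a b / a + b}.
Proof.
move=> a b; rewrite -(quotient_reprK u) !scaleE.
by rewrite scalerDl quotient_mapD.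
Qed.

HB.instance Definition _ := GRing.Zmodule_isLmodule.Build R[i] T
  scaleA scale1 scaleDr scaleDl.

Lemma quotient_mapZ a x : q (a *: x) = a *: q x.
Proof. by rewrite -scaleE. Qed.

(* The infimum of the norms over the coset [u]. Norms take their values in
   [R[i]], so the infimum is computed on their real parts. *)
Definition quotient_norm (u : T) : R[i] :=
  (inf [set complex.Re `|x| | x in [set x | q x = u]])%:C.

Let rn (x : L) : R := complex.Re `|x|.

Let rnE x : `|x| = (rn x)%:C.
Proof. by rewrite RRe_real// normr_real. Qed.

Let rn_ge0 x : 0 <= rn x.
Proof. by rewrite -lecR -rnE normr_ge0. Qed.

Let qn u : R := inf [set rn x | x in [set x | q x = u]].

Let qn_set_neq0 u : [set rn x | x in [set x | q x = u]] !=set0.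
Proof.
by exists (rn (quotient_repr u)); exists (quotient_repr u) => //=; exact: quotient_reprK.
Qed.

Let qn_lb u : has_lbound [set rn x | x in [set x | q x = u]].
Proof. by exists 0 => _ [x _ <-]; exact: rn_ge0. Qed.

Let qn_le x : qn (q x) <= rn x.
Proof. by apply: (ge_inf (qn_lb _)); exists x. Qed.

Let qn_ge u c : (forall x, q x = u -> c <= rn x) -> c <= qn u.
Proof.
by move=> h; apply: lb_le_inf => // _ [x /= xu <-]; exact: h.
Qed.

Let qn_ge0 u : 0 <= qn u.
Proof. by apply: qn_ge => x _; exact: rn_ge0. Qed.

Let qn_lt u e : qn u < e -> exists2 x, q x = u & rn x < e.
Proof. by move=> /(inf_lt (qn_set_neq0 u))[_ [x /= xu <-]]; exists x. Qed.

Let reD (a b : R) : (a + b)%:C = a%:C + b%:C.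
Proof. exact: rmorphD. Qed.

Let reM (a b : R) : (a * b)%:C = a%:C * b%:C.
Proof. exact: rmorphM. Qed.

Let quotient_ler_normD u v :
  quotient_norm (u + v) <= quotient_norm u + quotient_norm v.
Proof.
rewrite -reD lecR; apply/ler_addgt0Pr => e e0.
have e2 : 0 < e / 2 by rewrite divr_gt0.
have [|x xu xe] := @qn_lt u (qn u + e / 2); first by rewrite ltrDl.
have [|y yv ye] := @qn_lt v (qn v + e / 2); first by rewrite ltrDl.
rewrite [e]splitr addrACA (le_trans _ (ltW (ltrD xe ye)))//.
rewrite -xu -yv -quotient_mapD (le_trans (qn_le _))//.
by rewrite -lecR reD -!rnE; exact: ler_normD.
Qed.

Let rnZ a x : rn (a *: x) = complex.Re `|a| * rn x.
Proof.
by apply: (@complexI R); rewrite reM -!rnE RRe_real ?normr_real// normrZ.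
Qed.

Let normRe_ge0 (a : R[i]) : 0 <= complex.Re `|a|.
Proof. by rewrite -lecR RRe_real ?normr_real// normr_ge0. Qed.

Let qn_mul c d u : 0 <= c -> (forall x, q x = u -> d <= c * rn x) ->
  d <= c * qn u.
Proof.
rewrite le_eqVlt => /predU1P[<-|c0] h.
  by have := h _ (quotient_reprK u); rewrite !mul0r.
rewrite mulrC -ler_pdivrMr//; apply: qn_ge => x /h.
by rewrite ler_pdivrMr// mulrC.
Qed.

Let quotient_normZ (a : R[i]) u : quotient_norm (a *: u) = `|a| * quotient_norm u.
Proof.
have le (b : R[i]) v : qn (b *: v) <= complex.Re `|b| * qn v.
  by apply: qn_mul => // x <-; rewrite -quotient_mapZ -rnZ; exact: qn_le.
suff E : qn (a *: u) = complex.Re `|a| * qn u.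
  by rewrite -[`|a|]RRe_real ?normr_real// -reM -E.
apply/eqP; rewrite eq_le le andTb; have [->|a0] := eqVneq a 0.
  by rewrite normr0 mul0r; exact: qn_ge0.
rewrite -[X in qn X]scale1r -(mulVf a0) -scalerA.
apply: le_trans (ler_wpM2l (normRe_ge0 a) (le _ _)) _.
rewrite mulrA -lecR reM reM !RRe_real ?normr_real//.
by rewrite -normrM mulfV// normr1 mul1r.
Qed.

Let quotient_norm_eq0 u : quotient_norm u = 0 -> u = 0.
Proof.
move=> /complexI u0; rewrite -(quotient_reprK u) -[RHS](_ : q 0 = 0); last first.
  by rewrite -[0 in LHS](subrr 0) quotient_mapD quotient_mapN subrr.
apply/quotient_mapP; rewrite subr0; apply: (ideal_closed (c := I)).
move=> B; rewrite -nbhs_ballE => -[e /= e0 eB].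
have eE : e = (complex.Re e)%:C by rewrite RRe_real// gtr0_real.
have [|x xu xe] := @qn_lt u (complex.Re e).
  by rewrite /qn u0 -ltcR -eE.
exists (quotient_repr u - x); split.
  by apply/quotient_mapP; rewrite quotient_reprK.
by apply: eB; rewrite -ball_normE /= opprB addrC subrK rnE eE ltcR.
Qed.

HB.instance Definition _ := @Lmodule_isNormed.Build R[i] T
  quotient_norm quotient_ler_normD quotient_normZ quotient_norm_eq0.

Let normE (u : T) : `|u| = (qn u)%:C. Proof. by []. Qed.

Lemma quotient_map_norm x : `|q x| <= `|x|.
Proof. by rewrite normE rnE lecR. Qed.

Let complete (F : set_system T) : ProperFilter F -> cauchy F -> cvg F.
Proof.
apply: fast_cauchy_complete => y hy.
have /choice[d hd] n : exists x, q x = y n.+1 - y n /\ `|x| < 2^-1 ^+ n.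
  have eE : (2^-1 : R[i]) ^+ n = ((2^-1 : R) ^+ n)%:C.
    by rewrite rmorphXn fmorphV rmorph_nat.
  have := hy n; rewrite normE eE ltcR => /qn_lt[x xy xn]; exists x.
  by rewrite rnE ltcR.
pose x := fix x n := if n is m.+1 then d m + x m else quotient_repr (y 0%N).
have qx n : q (x n) = y n.
  elim: n => [|n IHn] /=; first exact: quotient_reprK.
  by rewrite quotient_mapD IHn (hd n).1 subrK.
have [|l xl] := @fast_cauchy_cvg R L x.
  by move=> n; rewrite /= addrK; exact: (hd n).2.
exists (q l); apply/cvgrPdist_lt => e e0.
move/cvgrPdist_lt : xl => /(_ e e0); apply: filterS => n.
by apply: le_lt_trans; rewrite -qx -quotient_mapN -quotient_mapD quotient_map_norm.
Qed.

HB.instance Definition _ := Uniform_isComplete.Build T complete.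

Definition quotient_lie (u v : T) : T :=
  q (lie (quotient_repr u) (quotient_repr v)).

Let lieE x y : quotient_lie (q x) (q y) = q (lie x y).
Proof.
apply/quotient_mapP; set x' := quotient_repr _; set y' := quotient_repr _.
have Ix : ideal_set I (x' - x) by apply/quotient_mapP; rewrite quotient_reprK.
have Iy : ideal_set I (y' - y) by apply/quotient_mapP; rewrite quotient_reprK.
have -> : lie x' y' - lie x y = lie x' (y' - y) + lie (x' - x) y.
  by rewrite lieDr lieDl lieNr lieNl subrKA.
by apply: idealD; [exact: ideal_liel|exact: ideal_lier].
Qed.

Let quotient_linearl v : linear (fun u => quotient_lie u v).
Proof.
move=> a x y; rewrite -(quotient_reprK x) -(quotient_reprK y).
rewrite -(quotient_reprK v) -quotient_mapZ -quotient_mapD !lieE.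
by rewrite lie_linearl quotient_mapD quotient_mapZ.
Qed.

Let quotient_linearr v : linear (quotient_lie v).
Proof.
move=> a x y; rewrite -(quotient_reprK x) -(quotient_reprK y).
rewrite -(quotient_reprK v) -quotient_mapZ -quotient_mapD !lieE.
by rewrite lie_linearr quotient_mapD quotient_mapZ.
Qed.

Let map0 : q 0 = 0.
Proof. by rewrite -[0 in LHS](subrr 0) quotient_mapD quotient_mapN subrr. Qed.

Let quotient_liexx x : quotient_lie x x = 0.
Proof. by rewrite -(quotient_reprK x) lieE liexx map0. Qed.

Let quotient_jacobi x y z : quotient_lie x (quotient_lie y z) +
  quotient_lie y (quotient_lie z x) + quotient_lie z (quotient_lie x y) = 0.
Proof.
rewrite -(quotient_reprK x) -(quotient_reprK y) -(quotient_reprK z).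
by rewrite !lieE -!quotient_mapD lie_jacobi map0.
Qed.

Let quotient_bounded : exists2 t : R[i], 0 < t &
  forall x y, `|quotient_lie x y| <= t * `|x| * `|y|.
Proof.
have [t t0 ht] := @lie_bounded R L; exists t => // u v.
have tE : t = (complex.Re t)%:C by rewrite RRe_real// gtr0_real.
have Ret0 : 0 <= complex.Re t by rewrite -lecR -tE ltW.
rewrite tE !normE -!reM lecR.
apply: qn_mul => [|y <-]; first by rewrite mulr_ge0.
rewrite mulrAC; apply: qn_mul => [|x <-]; first by rewrite mulr_ge0.
rewrite lieE (le_trans (qn_le _))// -lecR !reM -!rnE -tE mulrAC.
exact: ht.
Qed.

HB.instance Definition _ := isBanachLie.Build R T quotient_linearl
  quotient_linearr quotient_liexx quotient_jacobi quotient_bounded.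

Lemma quotient_map_lie x y : q (lie x y) = lie (q x) (q y).
Proof. by rewrite -lieE. Qed.

End QuotientBanachLie.

Arguments quotient_map {R L} I x.

Section Preradicals.
Variable R : realType.

(* The type also covers maps, such as [subideal_span P] and [star P], whose values
   are not known to be closed ideals by construction. *)
Definition ideal_map := forall L : banachLieType R, set L.

Implicit Types (P : ideal_map) (L M : banachLieType R).

Definition bounded_lie_hom L M (f : {linear L -> M}) :=
  (forall x y, f (lie x y) = lie (f x) (f y)) /\
  (exists C : R[i], forall x, `|f x| <= C * `|x|).

Definition preradical P :=
  (forall L, closed (P L) /\ lie_ideal (P L)) /\
  (forall L M (f : {linear L -> M}),
     bounded_lie_hom f -> dense (range f) -> f @` P L `<=` P M).

(* [P (P L) = P L], with [P L] seen as the Banach Lie algebra [I]. For a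
   preradical [P] such an [I] exists. *)
Definition lower_stable P :=
  forall L (I : closed_subalgebra L),
    subalgebra_set I = P L -> P (subalgebra_type I) = setT.

Definition Sem P L : Prop := P L = [set 0].

Definition span_solvable_ideals : ideal_map := fun L =>
  cspan (\bigcup_(I in [set I : set L |
    [/\ lie_ideal I, finite_dim I & solvable_set I]]) I).

Definition span_abelian_ideals : ideal_map := fun L =>
  cspan (\bigcup_(I in [set I : set L |
    [/\ lie_ideal I, closed I & commutative_set I]]) I).

Definition lie_centre : ideal_map := fun L =>
  [set x | forall y, lie x y = 0].

Definition subideal_span P : ideal_map := fun L =>
  cspan (\bigcup_(I in [set I : closed_subalgebra L |
    lie_subideal (subalgebra_set I) /\ P (subalgebra_type I) = setT])
    subalgebra_set I).

Definition next_stage P L (I : closed_ideal L) : set L :=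
  quotient_map I @^-1` P (quotient_type I).

Section WellOrder.
Variables (A : eqType) (le : rel A).

Definition wo_lt : rel A := fun a b => (a != b) && le a b.

Definition wo_least a := forall b, le a b.

Definition wo_succ a b := wo_lt a b /\ forall c, wo_lt a c -> le b c.

Definition wo_limit a := ~ wo_least a /\ ~ exists b, wo_succ b a.

(* Ordinals are represented by the elements of well-ordered types: [f a] is the
   stage indexed by the order type of [{b | b < a}]. *)
Definition transfinite_chain P L (f : A -> closed_ideal L) :=
  [/\ wochoice.well_order le,
      forall a, wo_least a -> ideal_set (f a) = [set 0],
      forall a b, wo_succ a b -> ideal_set (f b) = next_stage P (f a)
    & forall a, wo_limit a ->
        ideal_set (f a) = closure (\bigcup_(b in [set b | wo_lt b a])
                                     ideal_set (f b))].

End WellOrder.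

(* Some stage [I] of the chain is equal to the next one; the chain is then
   constant from there on. *)
Definition stable_value P L (I : closed_ideal L) :=
  (exists (A : eqType) (le : rel A) (f : A -> closed_ideal L) (a : A),
     transfinite_chain le P f /\ f a = I) /\ next_stage P I = ideal_set I.

Definition star P : ideal_map := fun L =>
  \bigcup_(I in [set I | stable_value P (L := L) I]) ideal_set I.

End Preradicals.

Arguments Sem {R} P L.
Arguments subideal_span {R} P L.
Arguments star {R} P L.
Arguments span_solvable_ideals R L : clear implicits.
Arguments span_abelian_ideals R L : clear implicits.
Arguments lie_centre R L : clear implicits.

(* Main.v *)
Require Import Defs.
From HB Require Import structures.
From mathcomp Require Import all_boot all_order all_algebra.
From mathcomp Require Import complex ring.
From mathcomp Require Import all_classical reals topology normedtype sequences.

Set Implicit Arguments.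
Unset Strict Implicit.
Unset Printing Implicit Defensive.

Import Order.TTheory GRing.Theory Num.Theory.
Import numFieldNormedType.Exports.

Local Open Scope classical_set_scope.
Local Open Scope ring_scope.
Local Open Scope complex_scope.

(** Let [K] be the centre, [A] and [S] the closed spans of the closed commutative
    and of the finite-dimensional solvable ideals, and write [P^s] for the span
    of the closed subideals [N] with [P N = N].

    An algebra [N] with [A N = N] is the closed span of commutative ideals, whose
    closures are closed commutative subideals of the ambient algebra; hence
    [A^s = K^s] ([abelian_span_centre]).  Lines in a commutative algebra are
    ideals, so [K^s] is contained in [S^s] ([centre_span_sub_solvable]).  In the
    other direction, the last non-zero derived algebra of a finite-dimensional
    solvable subideal is a commutative subideal.  So [K^s], [A^s] and [S^s]
    vanish on the same algebras, those without non-zero finite-dimensional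
    commutative subideals ([Sem_centre], [Sem_solvable]).

    The values of [K^s] and [S^s] are closed ideals: for small [y] the operator
    [ad y] has an exponential, which is an automorphism of the Banach Lie algebra
    ([exp_ad_hom], [exp_adK]).  It permutes the closed subideals, hence preserves
    the spans; differentiating at the origin, the spans are invariant under
    [ad y] ([exp_ad_derive], [subideal_span_ideal]).

    If [J] is a closed ideal and [L / J] has no non-zero finite-dimensional
    commutative subideal, then by transfinite induction all the stages of the
    chain of [K^s] or [S^s] are contained in [J] ([chain_sub]).  The stable stage
    itself is such a [J], so it is the least one ([star_least]), a description
    that is the same for both maps.  The chain is realised as the tower of closed
    ideals generated by the passage to the next stage and by closed spans of
    unions, which inclusion well-orders and whose largest element is stable
    ([stable_value_exists]).

    In finite dimension there is a largest solvable ideal [r].  Automorphisms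
    [exp (ad y)] preserve the radical of a closed ideal, so that radicals increase
    along a chain of subideals and every solvable subideal is contained in a
    solvable ideal ([solvable_subideal_sub_ideal]).  Hence [L / r] has no non-zero
    commutative subideal, and [r] contains the least [J] as above; conversely the
    image of [r] in [L / J] is a solvable ideal, which must be zero. *)

(** * Subspaces, closures and bounded homomorphisms *)

Section Spans.
Variables (R : realType) (L : banachLieType R).
Implicit Types (A B : set L) (x y : L).

Lemma subspaceP A : subspace_set A <->
  A 0 /\ forall (a : R[i]) x y, A x -> A y -> A (a *: x + y).
Proof.
split=> -[A0 AD]; split.
- exact: set_mem.
- by move=> a x y Ax Ay; apply: set_mem; apply: AD; exact: mem_set.
- exact: mem_set.
- by move=> a x y /set_mem Ax /set_mem Ay; apply: mem_set; exact: AD.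
Qed.

Lemma subspace0 A : subspace_set A -> A 0.
Proof. by move=> /subspaceP[]. Qed.

Lemma subspaceD A x y : subspace_set A -> A x -> A y -> A (x + y).
Proof. by move=> /subspaceP[_ /(_ 1 x y)]; rewrite scale1r. Qed.

Lemma subspaceZ A (a : R[i]) x : subspace_set A -> A x -> A (a *: x).
Proof. by move=> /subspaceP[A0 /(_ a x 0)]; rewrite addr0 => h Ax; exact: h. Qed.

Lemma subspaceN A x : subspace_set A -> A x -> A (- x).
Proof. by move=> sA Ax; rewrite -scaleN1r; exact: subspaceZ. Qed.

Lemma subspaceB A x y : subspace_set A -> A x -> A y -> A (x - y).
Proof. by move=> sA Ax Ay; apply: subspaceD => //; exact: subspaceN. Qed.

Lemma subspaceT : subspace_set [set: L].
Proof. by apply/subspaceP. Qed.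

Lemma subspace_set0 : subspace_set [set (0 : L)].
Proof. by apply/subspaceP; split=> // a x y -> ->; rewrite scaler0 addr0. Qed.

Lemma subspace_sum A B : subspace_set A -> subspace_set B ->
  subspace_set [set x + y | x in A & y in B].
Proof.
move=> sA sB; apply/subspaceP; split.
  by exists 0; [exact: subspace0|exists 0; [exact: subspace0|rewrite addr0]].
move=> a _ _ [x1 Ax1 [y1 By1 <-]] [x2 Ax2 [y2 By2 <-]].
exists (a *: x1 + x2); first by case/subspaceP: sA => _; apply.
exists (a *: y1 + y2); first by case/subspaceP: sB => _; apply.
by rewrite scalerDr addrACA.
Qed.

Lemma lspan_subspace A : subspace_set (lspan A).
Proof.
apply/subspaceP; split=> [B [sB _]|a x y Ax Ay B AB]; first exact: subspace0.
by case: (AB) => /subspaceP[_ h] _; apply: h; [exact: Ax|exact: Ay].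
Qed.

Lemma sub_lspan A : A `<=` lspan A.
Proof. exact: sub_smallest. Qed.

Lemma lspan_min A B : subspace_set B -> A `<=` B -> lspan A `<=` B.
Proof. by move=> sB AB; exact: smallest_sub. Qed.

Lemma lspanS A B : A `<=` B -> lspan A `<=` lspan B.
Proof.
by move=> AB; apply: lspan_min (lspan_subspace _) _ => x /AB; exact: sub_lspan.
Qed.

Lemma finite_dimS A B : A `<=` B -> finite_dim B -> finite_dim A.
Proof. by move=> AB [s Bs]; exists s => x /AB; exact: Bs. Qed.

End Spans.

Section Closures.
Variable R : realType.

Lemma closure_normP (V : normedModType R[i]) (A : set V) (x : V) :
  closure A x <-> forall e : R[i], 0 < e -> exists2 a, A a & `|x - a| < e.
Proof.
split=> [Ax e e0|h B /nbhs_ballP[e /= e0 eB]].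
  have /Ax[a [Aa]] := nbhsx_ballx x _ e0.
  by rewrite -ball_normE /=; exists a.
by have [a Aa xa] := h _ e0; exists a; split => //; apply: eB; rewrite -ball_normE.
Qed.

(** The order of [R[i]] is partial and [C] is an arbitrary complex number; the
    hypothesis implies that [C * `|x - y|] is non-negative. *)
Lemma lipschitz_closure (V W : normedModType R[i]) (f : V -> W) (C : R[i])
    (A : set V) (B : set W) :
  (forall x y, `|f x - f y| <= C * `|x - y|) -> A `<=` f @^-1` B ->
  closure A `<=` f @^-1` closure B.
Proof.
move=> fC AB x /closure_normP Ax; apply/closure_normP => e e0.
have C0 : 0 < `|C| + 1 by rewrite ltr_wpDl.
have [|a Aa xa] := Ax (e / (`|C| + 1)); first by rewrite divr_gt0.
exists (f a); first exact: AB.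
have fxa := fC x a; have Cxa : 0 <= C * `|x - a| := le_trans (normr_ge0 _) fxa.
apply: le_lt_trans fxa _; rewrite -(ger0_norm Cxa) normrM normr_id.
rewrite (le_lt_trans (y := (`|C| + 1) * `|x - a|)) ?ler_wpM2r ?lerDl//.
by rewrite mulrC -ltr_pdivlMr.
Qed.

(** Bounded Lie homomorphisms, as a predicate on plain functions, so that maps
    between subalgebras and quotients need no bundled linear structure. *)
Definition bounded_hom (L M : banachLieType R) (f : L -> M) : Prop :=
  [/\ linear f, forall x y, f (lie x y) = lie (f x) (f y)
    & exists C : R[i], forall x, `|f x| <= C * `|x|].

Section Hom.
Variables (L M : banachLieType R) (f : L -> M).
Hypothesis hf : bounded_hom f.

Lemma hom_lin (a : R[i]) x y : f (a *: x + y) = a *: f x + f y.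
Proof. by case: hf => h _ _; exact: h. Qed.

Lemma hom_lie x y : f (lie x y) = lie (f x) (f y).
Proof. by case: hf => _ h _; exact: h. Qed.

Lemma hom0 : f 0 = 0.
Proof. by have := hom_lin (-1) 0 0; rewrite scaler0 addr0 scaleN1r addNr. Qed.

Lemma homD x y : f (x + y) = f x + f y.
Proof. by have := hom_lin 1 x y; rewrite !scale1r. Qed.

Lemma homZ (a : R[i]) x : f (a *: x) = a *: f x.
Proof. by have := hom_lin a x 0; rewrite hom0 !addr0. Qed.

Lemma homB x y : f (x - y) = f x - f y.
Proof. by rewrite homD -scaleN1r homZ scaleN1r. Qed.

Lemma hom_closure (A : set L) (B : set M) : A `<=` f @^-1` B ->
  closure A `<=` f @^-1` closure B.
Proof.
have [_ _ [C fC]] := hf; apply: (@lipschitz_closure _ _ _ C) => x y.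
by rewrite -homB.
Qed.

Lemma closed_preimage_hom (B : set M) : closed B -> closed (f @^-1` B).
Proof.
by move=> cB x xB; apply: cB; apply: hom_closure xB.
Qed.

Lemma subspace_preimage (B : set M) : subspace_set B -> subspace_set (f @^-1` B).
Proof.
move=> /subspaceP[B0 BD]; apply/subspaceP; split; first by rewrite /= hom0.
by move=> a x y /= Bx By; rewrite hom_lin; exact: BD.
Qed.

Lemma subspace_image (A : set L) : subspace_set A -> subspace_set (f @` A).
Proof.
move=> /subspaceP[A0 AD]; apply/subspaceP; split; first by exists 0; rewrite ?hom0.
move=> a _ _ [x Ax <-] [y Ay <-]; exists (a *: x + y); last exact: hom_lin.
exact: AD.
Qed.

Lemma hom_lspan (A : set L) (B : set M) : A `<=` f @^-1` B ->
  lspan A `<=` f @^-1` lspan B.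
Proof.
move=> AB; apply: lspan_min => [|x /AB]; last exact: (@sub_lspan _ _ B).
exact: subspace_preimage (lspan_subspace _).
Qed.

Lemma hom_cspan (A : set L) (B : set M) : A `<=` f @^-1` B ->
  cspan A `<=` f @^-1` cspan B.
Proof. by move=> AB; apply: hom_closure; exact: hom_lspan. Qed.

Lemma image_finite_dim (A : set L) : finite_dim A -> finite_dim (f @` A).
Proof.
move=> [s As]; exists (map f s) => _ [x /As xs <-].
by apply: (@hom_lspan _ [set` map f s]) xs => y /= ys; exact: map_f.
Qed.

End Hom.

Lemma hom_comp (L M N : banachLieType R) (f : L -> M) (g : M -> N) :
  bounded_hom f -> bounded_hom g -> bounded_hom (g \o f).
Proof.
move=> hf hg; split=> [a x y|x y|] /=.
- by rewrite (hom_lin hf) (hom_lin hg).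
- by rewrite (hom_lie hf) (hom_lie hg).
have [_ _ [C fC]] := hf; have [_ _ [D gD]] := hg.
exists (`|D| * `|C|) => x.
have gle : `|g (f x)| <= `|D| * `|f x|.
  have Dfx : 0 <= D * `|f x| := le_trans (normr_ge0 _) (gD _).
  by rewrite (le_trans (gD _))// -[leLHS](ger0_norm Dfx) normrM normr_id.
apply: le_trans gle _; rewrite -mulrA ler_wpM2l//.
have Cx : 0 <= C * `|x| := le_trans (normr_ge0 _) (fC _).
by rewrite (le_trans (fC _))// -[leLHS](ger0_norm Cx) normrM normr_id.
Qed.

Lemma hom_id (L : banachLieType R) : bounded_hom (@id L).
Proof. by split=> //; exists 1 => x; rewrite mul1r. Qed.

Section ClosureLie.
Variable L : banachLieType R.
Implicit Types (A B C I J : set L) (x y : L).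

Lemma closure_subset_closed A B : closed B -> A `<=` B -> closure A `<=` B.
Proof. by move=> cB AB x /(closureS AB); exact: cB. Qed.

Lemma lieBr x y z : lie x (y - z) = lie x y - lie x z :> L.
Proof. by rewrite lieDr lieNr. Qed.

Lemma lieBl x y z : lie (x - y) z = lie x z - lie y z :> L.
Proof. by rewrite lieDl lieNl. Qed.

Lemma lieZr (a : R[i]) x y : lie x (a *: y) = a *: lie x y :> L.
Proof. by have := lie_linearr x a y 0; rewrite lie0r !addr0. Qed.

Lemma lieZl (a : R[i]) x y : lie (a *: x) y = a *: lie x y :> L.
Proof. by have := lie_linearl y a x 0; rewrite lie0l !addr0. Qed.

Lemma lie_leibniz y u v : lie y (lie u v) = lie (lie y u) v + lie u (lie y v) :> L.
Proof.
have := lie_jacobi y u v; rewrite (lieC v y) lieNr (lieC v (lie y u)).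
by rewrite -addrA -opprD => /eqP; rewrite subr_eq0 addrC => /eqP.
Qed.

(** Separate continuity of the bracket, used in each variable in turn. *)
Lemma closure_lie A B C : (forall x y, A x -> B y -> C (lie x y)) ->
  forall x y, closure A x -> closure B y -> closure C (lie x y).
Proof.
have [t t0 ht] := @lie_bounded R L => ABC x y Ax By.
have h a : A a -> closure C (lie a y).
  move=> Aa; apply: (@lipschitz_closure _ _ (lie a) (t * `|a|) B C) By => [u v|v].
    by rewrite -lieBr.
  exact: ABC.
apply: closed_closure.
apply: (@lipschitz_closure _ _ (lie^~ y) (t * `|y|) A (closure C)) Ax => [u v|//].
by rewrite -lieBl mulrAC.
Qed.

Lemma closure_subspace A : subspace_set A -> subspace_set (closure A).
Proof.
move=> /subspaceP[A0 AD]; apply/subspaceP; split; first exact: subset_closure.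
move=> a x y Ax Ay.
have h u : A u -> closure A (a *: u + y).
  move=> Au; apply: (@lipschitz_closure _ _ (fun v => a *: u + v) 1 A A) Ay.
    by move=> v w; rewrite mul1r opprD addrACA subrr add0r.
  by move=> v Av; exact: AD.
apply: closed_closure.
apply: (@lipschitz_closure _ _ (fun u => a *: u + y) `|a| A (closure A)) Ax => //.
by move=> v w; rewrite opprD addrACA subrr addr0 -scalerBr normrZ.
Qed.

Lemma cspan_subspace A : subspace_set (cspan A).
Proof. exact: closure_subspace (lspan_subspace _). Qed.

Lemma sub_cspan A : A `<=` cspan A.
Proof. by move=> x Ax; apply: subset_closure; exact: sub_lspan. Qed.

Lemma cspan_min A B : closed B -> subspace_set B -> A `<=` B -> cspan A `<=` B.
Proof. by move=> cB sB AB; apply: closure_subset_closed => //; exact: lspan_min. Qed.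

Lemma closed_zero : closed [set (0 : L)].
Proof. exact: accessible_closed_set1 (hausdorff_accessible (@norm_hausdorff _ _)) _. Qed.

Lemma closure_set0 x : closure [set (0 : L)] x -> x = 0.
Proof. exact: closed_zero. Qed.

End ClosureLie.

End Closures.

(** * Ideals, subideals and derived series *)

Section Ideals.
Variables (R : realType) (L : banachLieType R).
Implicit Types (A B C I J N : set L) (x y : L).

Lemma lie_idealr I J x y : lie_ideal_of I J -> I x -> J y -> I (lie x y).
Proof. by move=> [sI _ h] Ix Jy; rewrite lieC; apply: subspaceN => //; exact: h. Qed.

Lemma ideal_subalgebra I J : lie_ideal_of I J -> lie_subalgebra I.
Proof. by move=> [sI IJ h]; split=> // x y /IJ Jx Iy; exact: h. Qed.

Lemma subalgebra_ideal I : lie_subalgebra I -> lie_ideal_of I I.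
Proof. by move=> [sI h]; split. Qed.

Lemma subideal_subalgebra N : lie_subideal N -> lie_subalgebra N.
Proof. by move=> [n [J [<- _ h _]]]; exact: h. Qed.

Lemma subideal_ideal I N : lie_subideal N -> lie_ideal_of I N -> lie_subideal I.
Proof.
move=> [n [J [J0 Jn sJ hJ]]] IN.
exists n.+1, (fun i => if i is j.+1 then J j else I); split=> //.
- by move=> [|i] ?; [exact: ideal_subalgebra IN|exact: sJ].
- by move=> [|i] ?; [rewrite J0|exact: hJ].
Qed.

Lemma ideal_subideal I : lie_ideal I -> lie_subideal I.
Proof.
apply: subideal_ideal; exists 0%N, (fun=> setT); split=> //.
by move=> *; split=> //; exact: subspaceT.
Qed.

Lemma closure_subalgebra I : lie_subalgebra I -> lie_subalgebra (closure I).
Proof. by move=> [sI h]; split; [exact: closure_subspace|exact: closure_lie]. Qed.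

Lemma closure_ideal I J : lie_ideal_of I J -> lie_ideal_of (closure I) (closure J).
Proof.
by move=> [sI IJ h]; split;
  [exact: closure_subspace|exact: closureS|exact: closure_lie].
Qed.

Lemma closure_subideal N : lie_subideal N -> lie_subideal (closure N).
Proof.
move=> [n [J [J0 Jn sJ hJ]]]; exists n, (fun i => closure (J i)); split.
- by rewrite J0.
- by rewrite Jn closureT.
- by move=> i /sJ; exact: closure_subalgebra.
- by move=> i /hJ; exact: closure_ideal.
Qed.

Lemma closure_commutative A : commutative_set A -> commutative_set (closure A).
Proof.
move=> cA x y Ax Ay; suff: closure [set (0 : L)] (lie x y) by exact: closure_set0.
by apply: (closure_lie _ Ax Ay) => *; exact: cA.
Qed.

Lemma derived_subspace A : subspace_set (derived A).
Proof. exact: lspan_subspace. Qed.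

Lemma ad_preimage_subspace A x : subspace_set A -> subspace_set (lie x @^-1` A).
Proof.
move=> sA; apply/subspaceP; split=> [|a u v Au Av] /=.
  by rewrite lie0r; exact: (subspace0 sA).
by rewrite lieDr lieZr; apply: (subspaceD sA) => //; exact: (subspaceZ _ sA).
Qed.

Lemma ad_preimage_closed A x : closed A -> closed (lie x @^-1` A).
Proof.
have [t t0 ht] := @lie_bounded R L => cA u Au; apply: cA.
apply: (@lipschitz_closure _ _ _ (lie x) (t * `|x|) (lie x @^-1` A)) Au => // v w.
by rewrite -lieBr.
Qed.

Lemma cspan_ideal A : (forall x u, A u -> cspan A (lie x u)) -> lie_ideal (cspan A).
Proof.
move=> hA; split=> //; first exact: cspan_subspace.
move=> x u _; have sA := ad_preimage_subspace x (cspan_subspace A).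
have cA : closed (lie x @^-1` cspan A).
  by apply: ad_preimage_closed; exact: closed_closure.
by apply: (cspan_min cA sA) => v; exact: hA.
Qed.

Lemma derived_min A B : subspace_set B ->
  (forall x y, A x -> A y -> B (lie x y)) -> derived A `<=` B.
Proof. by move=> sB AB; apply: lspan_min => // _ [x [y [Ax Ay ->]]]; exact: AB. Qed.

Lemma derived_lie A x y : A x -> A y -> derived A (lie x y).
Proof. by move=> Ax Ay; apply: sub_lspan; exists x, y. Qed.

Lemma derivedS A B : A `<=` B -> derived A `<=` derived B.
Proof. by move=> AB; apply: lspanS => z [x [y [/AB Bx /AB By ->]]]; exists x, y. Qed.

Lemma iter_derivedS n A B : A `<=` B -> iter n (@derived _ _) A `<=` iter n (@derived _ _) B.
Proof. by move=> AB; elim: n => //= n IHn; exact: derivedS. Qed.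

Lemma derived_ideal I J : lie_subalgebra J -> lie_ideal_of I J ->
  lie_ideal_of (derived I) J.
Proof.
move=> sJ IJ; have [sI IsJ hI] := IJ.
have dI : derived I `<=` I by apply: derived_min => // x y /IsJ; exact: hI.
split; [exact: derived_subspace|by move=> x /dI /IsJ|move=> x y Jx].
suff: derived I `<=` lie x @^-1` derived I by exact.
apply: lspan_min; first exact: (ad_preimage_subspace x (derived_subspace I)).
move=> _ [u [v [Iu Iv ->]]] /=; rewrite lie_leibniz.
apply: (subspaceD (derived_subspace I)).
- by apply: derived_lie => //; exact: hI.
- by apply: derived_lie => //; exact: hI.
Qed.

Lemma commutative_solvable A : commutative_set A -> solvable_set A.
Proof.
move=> cA; exists 1%N; apply: derived_min; first exact: subspace_set0.
by move=> x y; exact: cA.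
Qed.

Lemma ideal_neq0 I J : lie_ideal_of I J -> I <> [set 0] -> ~ (I `<=` [set 0]).
Proof. by move=> [sI _ _] I0 I00; apply: I0; apply/seteqP; split=> // _ ->; exact: subspace0. Qed.

(** The last non-zero term of the derived series. *)
Lemma last_derived I J : lie_subalgebra J -> lie_ideal_of I J ->
  solvable_set I -> I <> [set 0] ->
  exists C, [/\ lie_ideal_of C J, commutative_set C, C `<=` I & C <> [set 0]].
Proof.
move=> sJ IJ [n]; elim: n I IJ => [|n IHn] I IJ In I0.
  by case: (ideal_neq0 IJ I0).
have dIJ := derived_ideal sJ IJ; have [sI IsJ hI] := IJ.
have [dI0|dI0] := pselect (derived I = [set 0]).
  exists I; split=> // x y Ix Iy; suff: derived I (lie x y) by rewrite dI0.
  exact: derived_lie.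
have [|C [CJ cC CI C0]] := IHn _ dIJ _ dI0; first by rewrite -iterSr.
exists C; split=> // x /CI; apply: derived_min x => // x y /IsJ; exact: hI.
Qed.

Lemma closure_solvable A : solvable_set A -> solvable_set (closure A).
Proof.
move=> [n An]; exists n.
suff h : iter n (@derived _ _) (closure A) `<=` closure (iter n (@derived _ _) A).
  by move=> x /h /(closureS An); exact: closure_set0.
elim: {An} n => //= n IHn; apply: derived_min.
  by apply: closure_subspace; exact: derived_subspace.
by move=> x y /IHn Ax /IHn Ay; apply: (closure_lie _ Ax Ay) => *; exact: derived_lie.
Qed.

Lemma sum_ideal A B J : lie_ideal_of A J -> lie_ideal_of B J ->
  subspace_set J -> lie_ideal_of [set x + y | x in A & y in B] J.
Proof.
move=> [sA AJ hA] [sB BJ hB] sJ; split; first exact: subspace_sum.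
  by move=> _ [x /AJ Jx [y /BJ Jy <-]]; exact: subspaceD.
move=> x _ Jx [u Au [v Bv <-]]; exists (lie x u); first exact: hA.
by exists (lie x v); [exact: hB|rewrite lieDr].
Qed.

(** The [n]-th derived set of [A + B] is contained in the sum of [B] and of the
    [n]-th derived set of [A]. *)
Lemma sum_solvable A B J : lie_ideal_of A J -> lie_ideal_of B J ->
  solvable_set A -> solvable_set B -> solvable_set [set x + y | x in A & y in B].
Proof.
move=> iA iB [n An] [m Bm]; set S := [set x + y | x in A & y in B].
have [sA AJ hA] := iA; have [sB BJ hB] := iB.
exists (m + n)%N; rewrite iterD.
have h : iter n (@derived _ _) S `<=` [set x + y | x in iter n (@derived _ _) A & y in B].
  elim: {An} n => // n IHn /=; have sn : iter n (@derived _ _) A `<=` A.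
    elim: {IHn} n => // n IHn /=; apply: derived_min => // x y /IHn Ax /IHn Ay.
    by apply: hA => //; exact: AJ.
  apply: derived_min => [|x y /IHn[a Aa [b Bb <-]] /IHn[a' Aa' [b' Bb' <-]]].
    by apply: subspace_sum => //; exact: derived_subspace.
  exists (lie a a'); first exact: derived_lie.
  exists (lie a b' + lie b (a' + b')); last by rewrite addrA -lieDr -lieDl.
  have Ja : J a by apply: AJ; exact: sn.
  have Ja' : J a' by apply: AJ; exact: sn.
  apply: subspaceD => //; first exact: hB.
  rewrite lieDr; apply: subspaceD => //; last by apply: hB => //; exact: BJ.
  exact: lie_idealr Bb Ja'.
have h' : iter n (@derived _ _) S `<=` B.
  by move=> x /h[a /An -> [b Bb <-]]; rewrite add0r.
by move=> x /(iter_derivedS h'); exact: Bm.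
Qed.

End Ideals.

Section HomIdeals.
Variables (R : realType) (L M : banachLieType R) (f : L -> M).
Hypothesis hf : bounded_hom f.
Implicit Types (A I J : set L) (B : set M).

Lemma image_ideal I J : lie_ideal_of I J -> lie_ideal_of (f @` I) (f @` J).
Proof.
move=> [sI IJ h]; split; first exact: subspace_image.
  exact: image_subset.
move=> _ _ [x Jx <-] [y Iy <-]; exists (lie x y); last exact: hom_lie.
exact: h.
Qed.

Lemma image_subalgebra I : lie_subalgebra I -> lie_subalgebra (f @` I).
Proof.
by move=> /subalgebra_ideal/image_ideal /ideal_subalgebra.
Qed.

Lemma image_commutative I : commutative_set I -> commutative_set (f @` I).
Proof.
by move=> cI _ _ [x Ix <-] [y Iy <-]; rewrite -(hom_lie hf) cI// (hom0 hf).
Qed.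

Lemma preimage_ideal B B' : lie_ideal_of B B' ->
  lie_ideal_of (f @^-1` B) (f @^-1` B').
Proof.
move=> [sB BB h]; split; first exact: subspace_preimage.
  exact: preimage_subset.
by move=> x y /= Jx Bx; rewrite (hom_lie hf); exact: h.
Qed.

Lemma image_derived A : derived (f @` A) `<=` f @` derived A.
Proof.
apply: derived_min; first by apply: subspace_image => //; exact: derived_subspace.
move=> _ _ [x Ax <-] [y Ay <-]; exists (lie x y); last exact: hom_lie.
exact: derived_lie.
Qed.

Lemma image_solvable A : solvable_set A -> solvable_set (f @` A).
Proof.
move=> [n An]; exists n.
suff h : iter n (@derived _ _) (f @` A) `<=` f @` iter n (@derived _ _) A.
  by move=> _ /h[x /An -> <-]; exact: hom0.
elim: {An} n => //= n IHn y /(derivedS IHn); exact: image_derived.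
Qed.

Lemma preimage_derived B : derived (f @^-1` B) `<=` f @^-1` derived B.
Proof.
apply: derived_min; first by apply: subspace_preimage => //; exact: derived_subspace.
by move=> x y Bx By /=; rewrite (hom_lie hf); exact: derived_lie.
Qed.

Lemma preimage_solvable B : solvable_set (f @^-1` [set 0]) -> solvable_set B ->
  solvable_set (f @^-1` B).
Proof.
move=> [m Km] [n Bn]; exists (m + n)%N; rewrite iterD.
have h : iter n (@derived _ _) (f @^-1` B) `<=` f @^-1` iter n (@derived _ _) B.
  by elim: {Bn} n => //= n IHn y /(derivedS IHn); exact: preimage_derived.
have h' : iter n (@derived _ _) (f @^-1` B) `<=` f @^-1` [set 0] by move=> x /h /Bn.
by move=> x /(iter_derivedS h'); exact: Km.
Qed.

Hypothesis fT : range f = setT.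

Lemma image_lie_ideal I : lie_ideal I -> lie_ideal (f @` I).
Proof. by move=> /image_ideal; rewrite fT. Qed.

Lemma image_subideal N : lie_subideal N -> lie_subideal (f @` N).
Proof.
move=> [n [J [J0 Jn sJ hJ]]]; exists n, (fun i => f @` J i); split.
- by rewrite J0.
- by rewrite Jn.
- by move=> i /sJ; exact: image_subalgebra.
- by move=> i /hJ; exact: image_ideal.
Qed.

End HomIdeals.

(** * Inclusions of subalgebras and quotient maps *)

Section SubalgebraVal.
Variables (R : realType) (L : banachLieType R) (N : closed_subalgebra L).

(** The inclusion of a closed subalgebra. *)
Definition sub_val (u : subalgebra_type N) : L := val u.

Lemma sub_val_hom : bounded_hom sub_val.
Proof. by split=> //; exists 1 => x; rewrite mul1r. Qed.

Lemma sub_valT : range sub_val = subalgebra_set N.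
Proof.
apply/seteqP; split=> [_ [u _ <-]|x Nx]; first exact: subalgebra_val.
by exists (exist _ x (mem_set Nx)).
Qed.

Lemma sub_val_ideal (B : set (subalgebra_type N)) : lie_ideal B ->
  lie_ideal_of (sub_val @` B) N.
Proof. by move=> /(image_ideal sub_val_hom); rewrite sub_valT. Qed.

End SubalgebraVal.
Arguments sub_val {R L} N u.

Section QuotientMap.
Variables (R : realType) (L : banachLieType R) (I : closed_ideal L).

Lemma quotient_map_hom : bounded_hom (quotient_map I).
Proof.
split=> [a x y|x y|].
- by rewrite quotient_mapD quotient_mapZ.
- exact: quotient_map_lie.
by exists 1 => x; rewrite mul1r; exact: quotient_map_norm.
Qed.

Lemma quotient_mapT : range (quotient_map I) = setT.
Proof. by apply/seteqP; split=> // u _; exists (quotient_repr u) => //; exact: quotient_reprK. Qed.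

Lemma quotient_map_eq0 x : quotient_map I x = 0 <-> ideal_set I x.
Proof.
rewrite -[x in X in _ <-> X]subr0 -(quotient_mapP I x 0).
by rewrite (hom0 quotient_map_hom).
Qed.

Lemma quotient_map_ker : quotient_map I @^-1` [set 0] = ideal_set I.
Proof. by apply/seteqP; split=> x /quotient_map_eq0. Qed.

End QuotientMap.

(** * Convolutions of double sequences *)

Section DiagonalSums.
Variables (F : numFieldType) (V : lmodType F).
Implicit Type B : nat -> nat -> V.

(** The sum of the [B i j] with [i + j = k]. *)
Definition diag B (k : nat) : V := \sum_(i < k.+1) B i (k - i)%N.

Lemma sum_diag B n :
  \sum_(k < n) diag B k = \sum_(i < n) \sum_(0 <= j < n - i) B i j.
Proof.
elim: n => [|n IHn]; first by rewrite !big_ord0.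
rewrite big_ord_recr /= IHn /diag [RHS]big_ord_recr /= subSnn big_nat1.
rewrite [\sum_(i < n.+1) _]big_ord_recr /= subnn addrA -big_split; congr (_ + _).
by apply: eq_bigr => i _; rewrite subSn 1?ltnW// big_nat_recr.
Qed.

Lemma square_sub_diag B n :
  \sum_(i < n) \sum_(j < n) B i j - \sum_(k < n) diag B k =
  \sum_(i < n) \sum_(n - i <= j < n) B i j.
Proof.
rewrite sum_diag -sumrB; apply: eq_bigr => i _.
have -> : \sum_(j < n) B i j =
    \sum_(0 <= j < n - i) B i j + \sum_(n - i <= j < n) B i j.
  by rewrite -(big_mkord xpredT) (@big_cat_nat _ _ _ (n - i)%N) ?leq_subr.
by rewrite addrC addKr.
Qed.

(** Divided powers [x_k] of an operator [f] satisfy [k.+1 * x_k.+1 = f x_k]; if a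
    double sequence satisfies the Leibniz-like rule for [f], then its diagonal
    sums satisfy the rule of divided powers. *)
Lemma diag_rec B (f : V -> V) : f 0 = 0 -> {morph f : u v / u + v} ->
  (forall i j, i.+1%:R *: B i.+1 j + j.+1%:R *: B i j.+1 = f (B i j)) ->
  forall k, k.+1%:R *: diag B k.+1 = f (diag B k).
Proof.
move=> f0 fD hB k; rewrite /diag (big_morph f fD f0).
under [RHS]eq_bigr => i _ do rewrite -hB; rewrite big_split /=.
rewrite scaler_sumr.
transitivity (\sum_(i < k.+2) (i%:R *: B i (k.+1 - i)%N) +
  \sum_(i < k.+2) ((k.+1 - i)%:R *: B i (k.+1 - i)%N)).
  rewrite -big_split /=; apply: eq_bigr => i _; rewrite -scalerDl -natrD.
  by rewrite subnKC// -ltnS.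
congr (_ + _).
  by rewrite big_ord_recl /= scale0r add0r; apply: eq_bigr => i _; rewrite /bump.
rewrite big_ord_recr /= subnn scale0r addr0; apply: eq_bigr => i _.
by rewrite subSn// -ltnS.
Qed.

End DiagonalSums.

(** * Geometric limits *)

Section GeometricLimits.
Variable R : realType.
Local Notation half := (2^-1 : R[i]).

Lemma half_exp_ge0 n : 0 <= half ^+ n.
Proof. by rewrite exprn_ge0// invr_ge0. Qed.

Lemma half_exp_gt0 n : 0 < half ^+ n.
Proof. by rewrite exprn_gt0// invr_gt0. Qed.

Lemma half_exp_le1 n : half ^+ n <= 1.
Proof. by rewrite exprn_ile1 ?invr_ge0// invf_le1// ler1n. Qed.

(** Convergence at the rate [2 ^- n].  The explicit rate replaces filters in the
    study of the exponential. *)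
Definition geo_lim (V : normedModType R[i]) (u : nat -> V) (l : V) :=
  exists2 M : R[i], 0 <= M & forall n, `|u n - l| <= M * half ^+ n.

Lemma ge0_small (a M : R[i]) : 0 <= a -> 0 <= M ->
  (forall n, a <= M * half ^+ n) -> a = 0.
Proof.
move=> a0 M0 h; apply/eqP; rewrite eq_le a0 andbT.
rewrite real_leNgt ?ger0_real//; apply/negP => a1.
have M1 : 0 < M + 1 by rewrite ltr_wpDl.
have [|n hn] := @half_expn_lt R (a / (M + 1)); first by rewrite divr_gt0.
have := le_lt_trans (h n) (_ : M * half ^+ n < a); rewrite ltxx => H.
suff: false by []; apply: H; move: hn; rewrite ltr_pdivlMr// mulrC; apply: le_lt_trans.
by rewrite ler_wpM2r ?half_exp_ge0// lerDl.
Qed.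

Lemma le_geo (a b M : R[i]) : a \is Num.real -> b \is Num.real -> 0 <= M ->
  (forall n, a <= b + M * half ^+ n) -> a <= b.
Proof.
move=> ra rb M0 h; rewrite real_leNgt//; apply/negP => ab.
have : a - b = 0 by apply: (@ge0_small _ M) => // [|n]; rewrite ?lerBlDl// subr_ge0 ltW.
by move=> /eqP; rewrite subr_eq0 => /eqP ab'; move: ab; rewrite ab' ltxx.
Qed.

Section Normed.
Variable V : normedModType R[i].
Implicit Types (u v : nat -> V) (l m : V).

Lemma geo_lim_unique u l m : geo_lim u l -> geo_lim u m -> l = m.
Proof.
move=> [M M0 hM] [N N0 hN]; apply/eqP; rewrite -subr_eq0 -normr_eq0; apply/eqP.
apply: (@ge0_small _ (M + N)) => [//||n]; first exact: addr_ge0.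
rewrite -(subrK (u n) l) -addrA (le_trans (ler_normD _ _))// mulrDl.
by apply: lerD; [rewrite distrC; exact: hM|exact: hN].
Qed.

Lemma geo_limP u l (M : R[i]) : (forall n, `|u n - l| <= M * half ^+ n) ->
  geo_lim u l.
Proof.
move=> h; exists M => //; have := le_trans (normr_ge0 _) (h 0%N).
by rewrite expr0 mulr1.
Qed.

Lemma geo_limD u v l m : geo_lim u l -> geo_lim v m ->
  geo_lim (fun n => u n + v n) (l + m).
Proof.
move=> [M M0 hM] [N N0 hN]; apply: (@geo_limP _ _ (M + N)) => n.
by rewrite opprD addrACA mulrDl (le_trans (ler_normD _ _))// lerD ?hM ?hN.
Qed.

Lemma geo_lim0D u v l : geo_lim (fun n => u n - v n) 0 -> geo_lim v l -> geo_lim u l.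
Proof.
move=> uv vl; have := geo_limD uv vl; rewrite add0r => -[M M0 h]; exists M => // n.
by have := h n; rewrite subrK.
Qed.

Lemma geo_limZ (a : R[i]) u l : geo_lim u l -> geo_lim (fun n => a *: u n) (a *: l).
Proof.
move=> [M M0 hM]; apply: (@geo_limP _ _ (`|a| * M)) => n.
by rewrite -scalerBr normrZ -mulrA ler_wpM2l.
Qed.

Lemma geo_lim_closed (A : set V) u l : closed A -> (forall n, A (u n)) ->
  geo_lim u l -> A l.
Proof.
move=> cA Au [M M0 hM]; apply: cA; apply/closure_normP => e e0.
have M1 : 0 < M + 1 by rewrite ltr_wpDl.
have [|n hn] := @half_expn_lt R (e / (M + 1)); first by rewrite divr_gt0.
exists (u n) => //; rewrite distrC (le_lt_trans (hM n))//.
move: hn; rewrite ltr_pdivlMr// mulrC; apply: le_lt_trans.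
by rewrite ler_wpM2r ?half_exp_ge0// lerDl.
Qed.

End Normed.

Lemma geo_lim_lie (L : banachLieType R) (u v : nat -> L) (l m : L) :
  geo_lim u l -> geo_lim v m -> geo_lim (fun n => lie (u n) (v n)) (lie l m).
Proof.
move=> [M M0 hM] [N N0 hN]; have [t t0 ht] := @lie_bounded R L.
apply: (@geo_limP _ _ _ (t * M * (`|m| + N) + t * `|l| * N)) => n.
have -> : lie (u n) (v n) - lie l m = lie (u n - l) (v n) + lie l (v n - m).
  by rewrite lieBl lieBr subrKA.
have vn : `|v n| <= `|m| + N.
  rewrite -(subrK m (v n)) addrC (le_trans (ler_normD _ _))// lerD2l.
  by rewrite (le_trans (hN n))// ler_piMr ?half_exp_le1.
rewrite (le_trans (ler_normD _ _))// mulrDl lerD//.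
  rewrite (le_trans (ht _ _))// [leRHS]mulrAC ler_pM//.
    by rewrite mulr_ge0// ltW.
  by rewrite -mulrA ler_pM2l.
by rewrite (le_trans (ht _ _))// -[leRHS]mulrA ler_wpM2l// mulr_ge0// ltW.
Qed.

(** Geometrically bounded double families have the same square and triangular
   partial sums in the limit: they differ by at most [n ^ 2] terms, each of size
    at most [M * 8 ^- n]. *)
Lemma geo_lim_square_diag (V : normedModType R[i]) (B : nat -> nat -> V) (M : R[i]) :
  0 <= M -> (forall i j, `|B i j| <= M * (8^-1) ^+ (i + j)) ->
  geo_lim (fun n => \sum_(i < n) \sum_(j < n) B i j - \sum_(k < n) diag B k) 0.
Proof.
move=> M0 hB; apply: (@geo_limP _ _ _ M) => n; rewrite subr0 square_sub_diag.
have h8 k : 0 <= (8^-1 : R[i]) ^+ k by rewrite exprn_ge0// invr_ge0.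
have inner (i : 'I_n) : `|\sum_(n - i <= j < n) B i j| <= n%:R * (M * 8^-1 ^+ n).
  rewrite (le_trans (ler_norm_sum _ _ _))//.
  apply: (@le_trans _ _ (\sum_(n - i <= j < n) M * 8^-1 ^+ n)).
    apply: ler_sum_nat => j /andP[ij _]; rewrite (le_trans (hB _ _))// ler_wpM2l//.
    rewrite ler_wiXn2l ?invr_ge0// ?invf_le1 ?ler1n//.
    by rewrite -leq_subLR.
  by rewrite sumr_const_nat -[leLHS]mulr_natl ler_wpM2r ?mulr_ge0// ler_nat leq_subr.
rewrite (le_trans (ler_norm_sum _ _ _))//.
apply: (@le_trans _ _ (\sum_(i < n) n%:R * (M * 8^-1 ^+ n))); first exact: ler_sum.
rewrite sumr_const card_ord -[leLHS]mulr_natl.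
have -> x : n%:R * (n%:R * (M * x)) = M * (n%:R * (n%:R * x)) :> R[i] by ring.
rewrite ler_wpM2l//.
have -> : (8^-1 : R[i]) ^+ n = half ^+ n * half ^+ n * half ^+ n.
  by rewrite -!exprMn -!invfM -!natrM.
have n2 : n%:R * half ^+ n <= 1.
  by rewrite exprVn ler_pdivrMr ?exprn_gt0// mul1r -natrX ler_nat ltnW// ltn_expl.
have -> : n%:R * (n%:R * (half ^+ n * half ^+ n * half ^+ n)) =
    (n%:R * half ^+ n) * (n%:R * half ^+ n) * half ^+ n by ring.
rewrite -[leRHS]mul1r ler_wpM2r ?half_exp_ge0// -[leRHS]mul1r ler_pM//.
- by rewrite mulr_ge0 ?half_exp_ge0.
- by rewrite mulr_ge0 ?half_exp_ge0.
Qed.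

End GeometricLimits.

(** * Exponentials of small inner derivations *)

Section Exponential.
Variables (R : realType) (L : banachLieType R).
Local Notation half := (2^-1 : R[i]).
Local Notation h8 := (8^-1 : R[i]).
Implicit Types (x y u v : L).

(** The divided power [(ad y) ^ k x / k!]. *)
Fixpoint ad_div y (k : nat) x : L :=
  if k is k'.+1 then (k%:R : R[i])^-1 *: lie y (ad_div y k' x) else x.

(** The partial sums of the exponential series of [ad y]. *)
Definition exp_sum y (n : nat) x : L := \sum_(k < n) ad_div y k x.

(** The smallness condition under which the exponential of [ad y] is defined;
    small multiples of any [y] satisfy it.  The constant [1 / 8] makes the error of
    a Cauchy product, of order [n ^ 2 * 8 ^- n], smaller than [2 ^- n]. *)
Definition ad_contraction y := forall x, `|lie y x| <= h8 * `|x|.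

Lemma ad_divS y k x : k.+1%:R *: ad_div y k.+1 x = lie y (ad_div y k x) :> L.
Proof. by rewrite /= scalerA divff ?scale1r// pnatr_eq0. Qed.

Lemma natr_scaleI (k : nat) x y : (k.+1%:R : R[i]) *: x = (k.+1%:R : R[i]) *: y -> x = y.
Proof. by apply: scalerI; rewrite pnatr_eq0. Qed.

Lemma ad_div_lin y k (a : R[i]) u v :
  ad_div y k (a *: u + v) = a *: ad_div y k u + ad_div y k v.
Proof.
elim: k => //= k ->; rewrite lieDr lieZr scalerDr !scalerA; congr (_ *: _ + _).
exact: mulrC.
Qed.

Lemma ad_div_ad y k u : ad_div y k (lie y u) = lie y (ad_div y k u).
Proof. by elim: k => //= k ->; rewrite lieZr. Qed.

Lemma ad_div0 y k : ad_div y k 0 = 0.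
Proof. by elim: k => //= k ->; rewrite lie0r scaler0. Qed.

Lemma ad_divZ y k (a : R[i]) u : ad_div y k (a *: u) = a *: ad_div y k u.
Proof. by have := ad_div_lin y k a u 0; rewrite ad_div0 !addr0. Qed.

Lemma ad_divN y k u : ad_div y k (- u) = - ad_div y k u.
Proof. by elim: k => //= k ->; rewrite lieNr scalerN. Qed.

Lemma ad_div_sum y k n (w : 'I_n -> L) :
  ad_div y k (\sum_(i < n) w i) = \sum_(i < n) ad_div y k (w i).
Proof.
have D : {morph ad_div y k : u v / u + v}.
  by move=> u v; have := ad_div_lin y k 1 u v; rewrite !scale1r.
exact: (big_morph _ D (ad_div0 y k)).
Qed.

(** Leibniz formula. *)
Lemma diag_ad_div_lie y u v k :
  diag (fun i j => lie (ad_div y i u) (ad_div y j v)) k = ad_div y k (lie u v).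
Proof.
elim: k => [|k IHk]; first by rewrite /diag big_ord1.
apply: (@natr_scaleI k); rewrite ad_divS -IHk.
apply: (@diag_rec _ _ _ (lie y)).
- exact: lie0r.
- by move=> a b; exact: lieDr.
by move=> i j; rewrite lie_leibniz -lieZl ad_divS -lieZr ad_divS.
Qed.

(** The divided powers of [ad y] and [ad (- y)] convolve to the identity. *)
Lemma diag_ad_div_inv y x k :
  diag (fun i j => ad_div y i (ad_div (- y) j x)) k = if k is 0 then x else 0.
Proof.
case: k => [|k]; first by rewrite /diag big_ord1.
apply: (@natr_scaleI k); rewrite scaler0; apply: (@diag_rec _ _ _ (fun=> 0)).
- by [].
- by move=> a b; rewrite addr0.
by move=> i j; rewrite ad_divS -ad_div_ad -ad_divZ ad_divS lieNl ad_divN subrr.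
Qed.

Lemma h8_ge0 k : 0 <= h8 ^+ k.
Proof. by rewrite exprn_ge0// invr_ge0. Qed.

Lemma h8_le_half k : h8 ^+ k <= half ^+ k.
Proof. by rewrite lerXn2r ?nnegrE ?invr_ge0// lef_pV2 ?posrE// ler_nat. Qed.

Lemma ad_div_le y (c : R[i]) : 0 <= c -> (forall x, `|lie y x| <= c * `|x|) ->
  forall k x, `|ad_div y k x| <= c ^+ k * `|x|.
Proof.
move=> c0 hc; elim=> [|k IHk] x /=; first by rewrite expr0 mul1r.
rewrite normrZ (@le_trans _ _ (`|lie y (ad_div y k x)|))//.
  rewrite ler_piMl// normfV normr_nat invf_le1 ?ltr0n// ler1n//.
by rewrite (le_trans (hc _))// exprS -mulrA ler_wpM2l.
Qed.

(** The remainder term on the left telescopes: it makes the induction on [p]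
    work. *)
Lemma exp_sum_tail y n p x : ad_contraction y ->
  `|exp_sum y (n + p) x - exp_sum y n x| + 2 * h8 ^+ (n + p) * `|x| <=
  2 * h8 ^+ n * `|x|.
Proof.
move=> cy; elim: p => [|p IHp]; first by rewrite addn0 subrr normr0 add0r.
apply: le_trans IHp; rewrite addnS /exp_sum big_ord_recr /= -/(exp_sum _ _ _).
rewrite addrAC (@le_trans _ _ (`|exp_sum y (n + p) x - exp_sum y n x| +
  (`|ad_div y (n + p) x| + 2 * h8 ^+ (n + p).+1 * `|x|)))//.
  by rewrite addrA lerD2r ler_normD.
rewrite lerD2l; have h0 : 0 <= h8 by rewrite invr_ge0.
rewrite (le_trans (lerD (ad_div_le h0 cy _ _) (lexx _)))// -mulrDl ler_wpM2r//.
rewrite exprS mulrA -[X in X + _]mul1r -mulrDl ler_wpM2r ?h8_ge0//.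
have -> : 1 + 2 * h8 = 5 / 4 by field.
by rewrite ler_pdivrMr// -natrM ler_nat.
Qed.

Lemma exp_ad_subproof y : ad_contraction y ->
  exists E : L -> L, forall x n, `|exp_sum y n x - E x| <= 2 * `|x| * h8 ^+ n.
Proof.
move=> cy; suff /choice[E hE] : forall x, exists l : L, forall n,
  `|exp_sum y n x - l| <= 2 * `|x| * h8 ^+ n by exists E.
move=> x; have x1 : 0 < `|x| + 1 by rewrite ltr_wpDl.
have h0 : 0 <= h8 by rewrite invr_ge0.
(* Dropping the first [N] terms brings the increments below [2 ^- n]. *)
have [|N hN] := @half_expn_lt R (`|x| + 1)^-1; first by rewrite invr_gt0.
have [|l hl] := @fast_cauchy_cvg R L (fun n => exp_sum y (n + N) x).
  move=> n; rewrite addSn /exp_sum big_ord_recr /= [_ + ad_div _ _ _]addrC addrK.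
  rewrite (le_lt_trans (ad_div_le h0 cy _ _))//.
  rewrite (le_lt_trans (ler_wpM2r (normr_ge0 _) (h8_le_half _)))// exprD -mulrA.
  rewrite -[ltRHS]mulr1 ltr_pM2l ?half_exp_gt0//.
  rewrite (@le_lt_trans _ _ (half ^+ N * (`|x| + 1)))//.
    by rewrite ler_wpM2l ?half_exp_ge0// lerDl.
  by rewrite -ltr_pdivlMr// mul1r.
exists l => n; rewrite real_leNgt ?normr_real//; last first.
  by rewrite ger0_real// mulr_ge0 ?h8_ge0// mulr_ge0.
apply/negP => hlt; have /cvgrPdist_lt/(_ _ (_ : 0 < _)) := hl.
move=> /(_ (`|exp_sum y n x - l| - 2 * `|x| * h8 ^+ n)).
rewrite subr_gt0 => /(_ hlt)[m _ /(_ (m + n)%N)] /=; rewrite leq_addr => /(_ isT).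
have := exp_sum_tail n (m + N) x cy; rewrite addnCA addnA.
set z := exp_sum y (m + n + N) x => tail.
have : `|exp_sum y n x - l| <= `|z - exp_sum y n x| + `|l - z|.
  by rewrite distrC [leRHS]addrC -[l - _](subrKA z) ler_normD.
move=> h1 h2; have := le_lt_trans h1 (_ : _ < `|exp_sum y n x - l|).
rewrite ltxx => h3; suff : false by []; apply: h3.
rewrite addrC -ltrBrDr (lt_le_trans h2)// lerD2l lerN2 (le_trans _ (le_trans tail _))//.
  by rewrite lerDl mulr_ge0// mulr_ge0 ?h8_ge0.
by rewrite mulrAC.
Qed.

(** The exponential of [ad y], with the identity as default value when [ad y] is
    not small. *)
Definition exp_ad y : L -> L :=
  if pselect (ad_contraction y) is left cy then sval (cid (exp_ad_subproof cy)) else id.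

Lemma exp_adP y : ad_contraction y ->
  forall x n, `|exp_sum y n x - exp_ad y x| <= 2 * `|x| * h8 ^+ n.
Proof. by move=> cy; rewrite /exp_ad; case: pselect => // cy'; case: cid. Qed.

Lemma exp_ad_lim y x : ad_contraction y -> geo_lim (exp_sum y ^~ x) (exp_ad y x).
Proof.
move=> cy; apply: (@geo_limP _ _ _ _ (2 * `|x|)) => n.
by rewrite (le_trans (exp_adP cy _ _))// ler_wpM2l ?mulr_ge0// h8_le_half.
Qed.

Lemma ad_contractionN y : ad_contraction y -> ad_contraction (- y).
Proof. by move=> cy x; rewrite lieNl normrN. Qed.

Lemma exp_ad_le y x : ad_contraction y -> `|exp_ad y x| <= 2 * `|x|.
Proof.
move=> /exp_adP/(_ x 0%N); rewrite /exp_sum big_ord0 sub0r normrN.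
by rewrite expr0 mulr1.
Qed.

Lemma exp_ad_lin y (a : R[i]) u v : ad_contraction y ->
  exp_ad y (a *: u + v) = a *: exp_ad y u + exp_ad y v.
Proof.
move=> cy; apply: geo_lim_unique (exp_ad_lim _ cy) _.
have := geo_limD (geo_limZ a (exp_ad_lim u cy)) (exp_ad_lim v cy).
congr geo_lim; apply/funext => n; rewrite /exp_sum scaler_sumr -big_split /=.
by apply: eq_bigr => k _; rewrite ad_div_lin.
Qed.

Lemma exp_ad_lie y u v : ad_contraction y ->
  exp_ad y (lie u v) = lie (exp_ad y u) (exp_ad y v).
Proof.
move=> cy; apply/esym; have [t t0 ht] := @lie_bounded R L.
have h0 : 0 <= h8 by rewrite invr_ge0.
apply: geo_lim_unique (geo_lim_lie (exp_ad_lim u cy) (exp_ad_lim v cy)) _.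
apply: geo_lim0D (exp_ad_lim (lie u v) cy).
have := @geo_lim_square_diag R L (fun i j => lie (ad_div y i u) (ad_div y j v))
  (t * `|u| * `|v|).
have M0 : 0 <= t * `|u| * `|v| by rewrite !mulr_ge0// ltW.
move=> /(_ M0) h.
suff -> : (fun n => lie (exp_sum y n u) (exp_sum y n v) - exp_sum y n (lie u v)) =
  (fun n => \sum_(i < n) \sum_(j < n) lie (ad_div y i u) (ad_div y j v) -
    \sum_(k < n) diag (fun i j => lie (ad_div y i u) (ad_div y j v)) k).
  apply: h => i j; rewrite (le_trans (ht _ _))//.
  have -> : t * `|u| * `|v| * h8 ^+ (i + j) =
     t * (h8 ^+ i * `|u|) * (h8 ^+ j * `|v|) by rewrite exprD; ring.
  have iu := ad_div_le h0 cy i u; have jv := ad_div_le h0 cy j v.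
  by apply: ler_pM => //; [rewrite mulr_ge0// ltW|rewrite ler_wpM2l// ltW].
apply/funext => n; congr (_ - _); last first.
  by apply: eq_bigr => k _; rewrite diag_ad_div_lie.
rewrite /exp_sum.
rewrite (big_morph (lie^~ _) (fun a b => lieDl a b _) (lie0l _)).
by apply: eq_bigr => i _; rewrite (big_morph (lie _) (fun a b => lieDr a b _) (lie0r _)).
Qed.

Lemma exp_ad_hom y : ad_contraction y -> bounded_hom (exp_ad y).
Proof.
move=> cy; split; first by move=> a u v; exact: exp_ad_lin.
  by move=> u v; exact: exp_ad_lie.
by exists 2 => x; exact: exp_ad_le.
Qed.

Lemma exp_adK y : ad_contraction y -> cancel (exp_ad (- y)) (exp_ad y).
Proof.
move=> cy x; have cNy := ad_contractionN cy; have h0 : 0 <= h8 by rewrite invr_ge0.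
(* The products of the partial sums converge to the composition; by the
   convolution identity, they also converge to [x]. *)
have lim1 : geo_lim (fun n => exp_sum y n (exp_sum (- y) n x))
    (exp_ad y (exp_ad (- y) x)).
  pose M : R[i] := 2 * (2 * `|x|).
  apply: (@geo_limP _ _ _ _ (M + M + M)) => n.
  set w := exp_sum (- y) n x; set z := exp_ad (- y) x.
  have -> : exp_sum y n w - exp_ad y z =
      (exp_sum y n (w - z) - exp_ad y (w - z)) + exp_ad y (w - z) +
      (exp_sum y n z - exp_ad y z).
    rewrite subrK.
    have -> : exp_sum y n (w - z) = exp_sum y n w - exp_sum y n z.
      rewrite /exp_sum -sumrB; apply: eq_bigr => k _.
      by rewrite addrC -scaleN1r ad_div_lin scaleN1r addrC.
    by rewrite subrKA.
  have hwz : `|w - z| <= 2 * `|x| * half ^+ n.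
    by rewrite (le_trans (exp_adP cNy _ _))// ler_wpM2l ?mulr_ge0// h8_le_half.
  have hz : `|z| <= 2 * `|x| := exp_ad_le _ cNy.
  rewrite !mulrDl (le_trans (ler_normD _ _))// lerD//.
    rewrite (le_trans (ler_normD _ _))// lerD//.
      rewrite (le_trans (exp_adP cy _ _))// (@le_trans _ _ (2 * `|w - z|))//.
        rewrite ler_piMr ?mulr_ge0// (le_trans (h8_le_half _))// half_exp_le1//.
      by rewrite /M -[leRHS]mulrA ler_wpM2l.
    by rewrite (le_trans (exp_ad_le _ cy))// /M -mulrA ler_wpM2l.
  rewrite (le_trans (exp_adP cy _ _))// ler_pM ?mulr_ge0 ?h8_ge0 ?h8_le_half//.
  by rewrite ler_wpM2l.
apply: geo_lim_unique lim1 _.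
have lim2 : geo_lim (fun n => \sum_(k < n)
    diag (fun i j => ad_div y i (ad_div (- y) j x)) k) x.
  apply: (@geo_limP _ _ _ _ `|x|) => -[|n].
    by rewrite big_ord0 sub0r normrN expr0 mulr1.
  rewrite big_ord_recl /= diag_ad_div_inv big1 ?addr0 ?subrr ?normr0 ?mulr_ge0 ?half_exp_ge0//.
  by move=> i _; rewrite diag_ad_div_inv.
apply: geo_lim0D lim2.
have h := @geo_lim_square_diag R L (fun i j => ad_div y i (ad_div (- y) j x)) `|x|
  (normr_ge0 _).
suff -> : (fun n => exp_sum y n (exp_sum (- y) n x) - \sum_(k < n)
    diag (fun i j => ad_div y i (ad_div (- y) j x)) k) =
  (fun n => \sum_(i < n) \sum_(j < n) ad_div y i (ad_div (- y) j x) -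
    \sum_(k < n) diag (fun i j => ad_div y i (ad_div (- y) j x)) k).
  apply: h => i j; rewrite (le_trans (ad_div_le h0 cy _ _))//.
  rewrite [leRHS]mulrC exprD -[leRHS]mulrA ler_wpM2l ?h8_ge0//; exact: (ad_div_le h0 cNy j x).
apply/funext => n; congr (_ - _); rewrite /exp_sum.
by apply: eq_bigr => i _; rewrite ad_div_sum.
Qed.

(** First-order expansion of the exponential. *)
Lemma exp_ad_near y (c : R[i]) x : 0 <= c -> c <= h8 ->
  (forall x, `|lie y x| <= c * `|x|) ->
  `|lie y x - (exp_ad y x - x)| <= 2 * c ^+ 2 * `|x|.
Proof.
move=> c0 c8 hc; have cy : ad_contraction y.
  by move=> u; rewrite (le_trans (hc u))// ler_wpM2r.
have c20 : 0 <= c ^+ 2 * `|x| by rewrite mulr_ge0// exprn_ge0.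
have step n : `|lie y x - (exp_sum y n.+2 x - x)| + 2 * h8 ^+ n * (c ^+ 2 * `|x|) <=
    2 * (c ^+ 2 * `|x|).
  elim: n => [|n IHn].
    have -> : exp_sum y 2 x = x + lie y x.
      by rewrite /exp_sum big_ord_recl big_ord1 /= invr1 scale1r.
    by rewrite [x + _]addrC addrK subrr normr0 add0r mulr1.
  apply: le_trans IHn; rewrite {1}/exp_sum big_ord_recr /= -/(ad_div y n.+2 x).
  rewrite -/(exp_sum y n.+2 x).
  set z := ad_div _ _ _; set w := exp_sum _ _ _.
  have hz : `|z| <= h8 ^+ n * (c ^+ 2 * `|x|).
    rewrite (le_trans (ad_div_le c0 hc _ _))// mulrA ler_wpM2r// -addn2 exprD.
    by rewrite ler_wpM2r ?exprn_ge0// lerXn2r ?nnegrE ?invr_ge0.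
  have -> : lie y x - (w + z - x) = (lie y x - (w - x)) - z.
    by rewrite [w + z - x]addrAC [in LHS]opprD addrA.
  rewrite (le_trans (lerD (ler_normB _ _) (lexx _)))// -addrA lerD2l.
  rewrite (le_trans (lerD hz (lexx _)))// -mulrDl ler_wpM2r//.
  rewrite exprS mulrA -[X in X + _]mul1r -mulrDl ler_wpM2r ?h8_ge0//.
  have -> : 1 + 2 * h8 = 5 / 4 by field.
  by rewrite ler_pdivrMr// -natrM ler_nat.
rewrite -mulrA; apply: (@le_geo _ _ _ (2 * `|x|)); rewrite ?normr_real ?mulr_ge0//.
  by rewrite ger0_real// mulr_ge0.
move=> n; set w := exp_sum y n.+2 x.
have -> : lie y x - (exp_ad y x - x) = (lie y x - (w - x)) + (w - exp_ad y x).
  by rewrite !opprB -addrA subrKA.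
rewrite (le_trans (ler_normD _ _))// lerD//.
  by rewrite (le_trans _ (step n))// lerDl !mulr_ge0 ?h8_ge0.
rewrite (le_trans (exp_adP cy _ _))// ler_wpM2l ?mulr_ge0//.
rewrite (le_trans (h8_le_half _))// ler_wiXn2l ?invr_ge0 ?invf_le1 ?ler1n//.
by rewrite (leq_trans (leqnSn _)).
Qed.

(** A closed subspace that is stable under [ad y] is stable under its
    exponential. *)
Lemma exp_ad_stable y (A : set L) x : ad_contraction y -> closed A -> subspace_set A ->
  (forall u, A u -> A (lie y u)) -> A x -> A (exp_ad y x).
Proof.
move=> cy cA sA hA Ax; apply: geo_lim_closed cA _ (exp_ad_lim x cy) => n.
have Ak k : A (ad_div y k x).
  by elim: k => //= k IHk; apply: subspaceZ => //; exact: hA.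
rewrite /exp_sum; elim: n => [|n IHn]; first by rewrite big_ord0; exact: subspace0.
by rewrite big_ord_recr; exact: subspaceD.
Qed.

(** A closed subspace stable under the exponentials of the small multiples of
    [ad y] is stable under [ad y], which is the derivative of the exponential
    at the origin. *)
Lemma exp_ad_derive y (A : set L) : closed A -> subspace_set A ->
  (forall a : R[i], ad_contraction (a *: y) -> forall x, A x -> A (exp_ad (a *: y) x)) ->
  forall x, A x -> A (lie y x).
Proof.
move=> cA sA hA x Ax; apply: cA; apply/closure_normP => e e0.
have [t t0 ht] := @lie_bounded R L; pose c0 := t * `|y|.
have c00 : 0 <= c0 by rewrite mulr_ge0// ltW.
have [|N1 hN1] := @half_expn_lt R (h8 / (c0 + 1)).
  by rewrite divr_gt0 ?invr_gt0// ltr_wpDl.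
pose M := 2 * c0 ^+ 2 * `|x|.
have M0 : 0 <= M by rewrite mulr_ge0// mulr_ge0// exprn_ge0.
have [|N2 hN2] := @half_expn_lt R (e / (M + 1)).
  by rewrite divr_gt0// ltr_wpDl.
(* [N1] makes [ad (a *: y)] a contraction, [N2] makes the error less than [e]. *)
pose a : R[i] := half ^+ (N1 + N2).
have a0 : 0 < a := half_exp_gt0 _ _.
have aN1 : a <= half ^+ N1.
  by rewrite /a exprD ler_piMr ?half_exp_ge0// half_exp_le1.
have aN2 : a <= half ^+ N2.
  by rewrite /a exprD ler_piMl ?half_exp_ge0// half_exp_le1.
have hc u : `|lie (a *: y) u| <= (a * c0) * `|u|.
  by rewrite lieZl normrZ (ger0_norm (ltW a0)) -mulrA ler_wpM2l ?(ltW a0).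
have c8 : a * c0 <= h8.
  move: hN1; rewrite ltr_pdivlMr ?ltr_wpDl// => /ltW; apply: le_trans.
  by rewrite ler_pM ?(ltW a0)// lerDl.
have ac0 : 0 <= a * c0 by rewrite mulr_ge0// ltW.
have cy : ad_contraction (a *: y) by move=> u; rewrite (le_trans (hc u))// ler_wpM2r.
exists (a^-1 *: (exp_ad (a *: y) x - x)).
  by apply: subspaceZ => //; apply: subspaceB => //; exact: hA.
have near := exp_ad_near x ac0 c8 hc.
have -> : lie y x - a^-1 *: (exp_ad (a *: y) x - x) =
    a^-1 *: (lie (a *: y) x - (exp_ad (a *: y) x - x)).
  by rewrite [RHS]scalerBr lieZl scalerA mulVf ?scale1r// gt_eqF.
rewrite normrZ normfV (ger0_norm (ltW a0)).
rewrite (@le_lt_trans _ _ (a * M))//.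
  rewrite mulrC ler_pdivrMr// (le_trans near)//.
  have -> // : 2 * (a * c0) ^+ 2 * `|x| = a * M * a by rewrite /M; ring.
move: hN2; rewrite ltr_pdivlMr ?ltr_wpDl//; apply: le_lt_trans.
by rewrite ler_pM ?(ltW a0)// lerDl.
Qed.

End Exponential.

(** * Spans of subideals *)

Section SubMap.
Variables (R : realType) (L : banachLieType R) (N N' : closed_subalgebra L).
Variables (f : L -> L) (hf : bounded_hom f).
Hypothesis fN : forall x, subalgebra_set N x -> subalgebra_set N' (f x).

(** The map from [N] to [N'] induced by [f]. *)
Definition sub_map (u : subalgebra_type N) : subalgebra_type N' :=
  exist _ (f (val u)) (mem_set (fN (subalgebra_val u))).

Lemma sub_map_hom : bounded_hom sub_map.
Proof.
split=> [a u v|u v|].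
- by apply: val_inj; exact: hom_lin.
- by apply: val_inj; exact: hom_lie.
by have [_ _ [C hC]] := hf; exists C => u; exact: hC.
Qed.

Lemma sub_mapT : (forall x, subalgebra_set N' x ->
    exists2 u, subalgebra_set N u & f u = x) -> range sub_map = setT.
Proof.
move=> fT; apply/seteqP; split=> // v _; have [x Nx fx] := fT _ (subalgebra_val v).
by exists (exist _ x (mem_set Nx)) => //; apply: val_inj.
Qed.

End SubMap.

Section SubidealSpan.
Variable R : realType.
Implicit Types (P : ideal_map R) (L M : banachLieType R).

(** The equality [P L = L] passes to surjective images; the invariance of subideal
    spans requires no more functoriality than this. *)
Definition surjection_stable P := forall L M (f : L -> M),
  bounded_hom f -> range f = setT -> P L = setT -> P M = setT.

Lemma subideal_span_subspace P L : subspace_set (subideal_span P L).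
Proof. exact: cspan_subspace. Qed.

Lemma subideal_span_closed P L : closed (subideal_span P L).
Proof. exact: closed_closure. Qed.

Lemma sub_subideal_span P L (N : closed_subalgebra L) : lie_subideal (subalgebra_set N) ->
  P (subalgebra_type N) = setT -> subalgebra_set N `<=` subideal_span P L.
Proof. by move=> sN PN x Nx; apply: sub_cspan; exists N. Qed.

Lemma subideal_span_min P L (A : set L) : closed A -> subspace_set A ->
  (forall N : closed_subalgebra L, lie_subideal (subalgebra_set N) ->
     P (subalgebra_type N) = setT -> subalgebra_set N `<=` A) ->
  subideal_span P L `<=` A.
Proof.
move=> cA sA hA; apply: cspan_min => // x [N [sN PN] Nx].
by apply: hA Nx.
Qed.

Lemma exp_ad_range L (y : L) : ad_contraction y -> range (exp_ad y) = setT.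
Proof.
move=> cy; apply/seteqP; split=> // x _; exists (exp_ad (- y) x) => //.
exact: exp_adK.
Qed.

Lemma subideal_span_exp_ad P L (y : L) : surjection_stable P -> ad_contraction y ->
  forall x, subideal_span P L x -> subideal_span P L (exp_ad y x).
Proof.
move=> sP cy; have hE := exp_ad_hom cy; have hE' := exp_ad_hom (ad_contractionN cy).
apply: subideal_span_min.
- exact: closed_preimage_hom hE _ (@subideal_span_closed P L).
- exact: subspace_preimage hE _ (@subideal_span_subspace P L).
move=> N sN PN x Nx.
have E'K : cancel (exp_ad y) (exp_ad (- y)).
  by move=> u; have := exp_adK (ad_contractionN cy) u; rewrite opprK.
have imN : exp_ad y @` N = exp_ad (- y) @^-1` N.
  apply/seteqP; split=> [_ [u Nu <-]|u Nu] /=; first by rewrite E'K.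
  by exists (exp_ad (- y) u) => //; exact: exp_adK.
have cN' : closed (exp_ad y @` N).
  by rewrite imN; apply: closed_preimage_hom hE' _ _; exact: subalgebra_closed.
pose N' := ClosedSubalgebra cN' (image_subalgebra hE (subalgebraP N)).
have NN' u : subalgebra_set N u -> subalgebra_set N' (exp_ad y u) by exists u.
apply: (@sub_subideal_span _ _ N'); last exact: NN'.
  by apply: image_subideal => //; exact: exp_ad_range.
apply: sP (sub_map_hom hE NN') _ PN.
by apply: sub_mapT => v [u Nu <-]; exists u.
Qed.

(** Subideal spans are invariant under the automorphisms [exp (ad y)], hence
    under their derivatives at the origin. *)
Lemma subideal_span_ideal P L : surjection_stable P -> lie_ideal (subideal_span P L).
Proof.
move=> sP; split=> //; first exact: subideal_span_subspace.
move=> y x _; apply: exp_ad_derive x => [||a cy x].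
- exact: subideal_span_closed.
- exact: subideal_span_subspace.
exact: subideal_span_exp_ad.
Qed.

Lemma centre_surjection_stable : surjection_stable (lie_centre R).
Proof.
move=> L M f hf fT cL; apply/seteqP; split=> // u _ v.
have [x _ <-] : range f u by rewrite fT.
have [y _ <-] : range f v by rewrite fT.
have : lie_centre R L x by rewrite cL.
by move=> /(_ y) xy; rewrite -(hom_lie hf) xy (hom0 hf).
Qed.

Lemma solvable_surjection_stable : surjection_stable (span_solvable_ideals R).
Proof.
move=> L M f hf fT sL; apply/seteqP; split=> // u _.
have [x _ <-] : range f u by rewrite fT.
have : span_solvable_ideals R L x by rewrite sL.
apply: (hom_cspan hf) => {}x [I [iI fI sI] Ix]; exists (f @` I); last by exists x.
split; [exact: image_lie_ideal|exact: image_finite_dim|exact: image_solvable].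
Qed.

(** [K N = N] means that [N] is commutative. *)
Lemma centre_setT L (N : closed_subalgebra L) :
  lie_centre R (subalgebra_type N) = setT <-> commutative_set (subalgebra_set N).
Proof.
split=> [cN x y Nx Ny|cN].
  have : lie_centre R _ (exist _ x (mem_set Nx) : subalgebra_type N) by rewrite cN.
  by move=> /(_ (exist _ y (mem_set Ny)))/(congr1 val).
apply/seteqP; split=> // u _ v; apply: val_inj.
by apply: cN; exact: subalgebra_val.
Qed.

Lemma commutative_sub_centre_span L (I : set L) : lie_subideal I ->
  commutative_set I -> I `<=` subideal_span (lie_centre R) L.
Proof.
move=> sI cI x Ix; have sN := closure_subideal sI.
pose N := ClosedSubalgebra (@closed_closure _ I) (subideal_subalgebra sN).
apply: (@sub_subideal_span _ _ N) => //; last exact: subset_closure.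
by apply/centre_setT; exact: closure_commutative.
Qed.

Lemma abelian_span_centre L :
  subideal_span (span_abelian_ideals R) L = subideal_span (lie_centre R) L.
Proof.
apply/seteqP; split.
  apply: subideal_span_min.
  - exact: subideal_span_closed.
  - exact: subideal_span_subspace.
  move=> N sN PN x Nx.
  have : span_abelian_ideals R _ (exist _ x (mem_set Nx) : subalgebra_type N).
    by rewrite PN.
  pose K := subideal_span (lie_centre R) L.
  have cK : closed (sub_val N @^-1` K).
    by apply: closed_preimage_hom (sub_val_hom N) _ _; exact: subideal_span_closed.
  have sK : subspace_set (sub_val N @^-1` K).
    by apply: subspace_preimage (sub_val_hom N) _ _; exact: subideal_span_subspace.
  move=> /(cspan_min cK sK); apply=> u [B [iB _ cB] Bu].
  have sB := subideal_ideal sN (sub_val_ideal iB).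
  apply: (commutative_sub_centre_span sB); last by exists u.
  exact: image_commutative (sub_val_hom N) _ cB.
apply: subideal_span_min.
- exact: subideal_span_closed.
- exact: subideal_span_subspace.
move=> N sN /centre_setT cN; apply: sub_subideal_span => //.
apply/seteqP; split=> // u _; apply: sub_cspan; exists setT => //; split.
- by split=> //; exact: subspaceT.
- exact: closedT.
by move=> v w _ _; apply: val_inj; apply: cN; exact: subalgebra_val.
Qed.

Lemma line_subspace L (x : L) : subspace_set (range ( *:%R^~ x : R[i] -> L)).
Proof.
apply/subspaceP; split; first by exists 0; rewrite ?scale0r.
move=> a _ _ [b _ <-] [c _ <-]; exists (a * b + c) => //.
by rewrite scalerDl scalerA.
Qed.

(** In a commutative algebra the lines are ideals. *)
Lemma centre_span_sub_solvable L :
  subideal_span (lie_centre R) L `<=` subideal_span (span_solvable_ideals R) L.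
Proof.
apply: subideal_span_min.
- exact: subideal_span_closed.
- exact: subideal_span_subspace.
move=> N sN cN; apply: sub_subideal_span => //.
apply/seteqP; split=> // u _; apply: sub_cspan.
have c (v w : subalgebra_type N) : lie v w = 0.
  by have : lie_centre R _ v by rewrite cN.
exists (range ( *:%R^~ u : R[i] -> subalgebra_type N)); last first.
  by exists 1; rewrite ?scale1r.
split.
- split=> //; first exact: line_subspace.
  by move=> v w _ _; rewrite c; apply: subspace0; exact: line_subspace.
- exists [:: u] => _ [a _ <-]; apply: (subspaceZ _ (lspan_subspace _)).
  by apply: sub_lspan; rewrite /= inE.
by apply: commutative_solvable => v w _ _.
Qed.

(** Every commutative finite-dimensional subideal of [L] is zero. *)
Definition no_commutative_subideal L := forall I : set L, lie_subideal I ->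
  commutative_set I -> finite_dim I -> I `<=` [set 0].

Lemma centre_Sem_no_commutative L : subideal_span (lie_centre R) L `<=` [set 0] ->
  no_commutative_subideal L.
Proof. by move=> h I sI cI _ x Ix; apply: h; exact: commutative_sub_centre_span Ix. Qed.

(** Otherwise the last non-zero derived set of [I] contradicts the hypothesis. *)
Lemma solvable_subideal_eq0 L (I N : set L) : no_commutative_subideal L ->
  lie_subideal N -> lie_ideal_of I N -> finite_dim I -> solvable_set I ->
  I `<=` [set 0].
Proof.
move=> nL sN IN fI sI; have [-> //|I0] := pselect (I = [set 0]).
have [C [CN cC CI C0]] := last_derived (subideal_subalgebra sN) IN sI I0.
case: (ideal_neq0 CN C0); apply: nL cC (finite_dimS CI fI).
exact: subideal_ideal CN.
Qed.

Lemma solvable_span_eq0 L M (f : L -> M) : bounded_hom f -> range f = setT ->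
  no_commutative_subideal M ->
  subideal_span (span_solvable_ideals R) L `<=` f @^-1` [set 0].
Proof.
move=> hf fT nM; apply: subideal_span_min.
- by apply: closed_preimage_hom hf _ _; exact: closed_zero.
- by apply: subspace_preimage hf _ _; exact: subspace_set0.
move=> N sN PN x Nx.
have hg := hom_comp (sub_val_hom N) hf; set g := f \o sub_val N in hg.
have : span_solvable_ideals R _ (exist _ x (mem_set Nx) : subalgebra_type N).
  by rewrite PN.
have cK := closed_preimage_hom hg (@closed_zero _ M).
have sK := subspace_preimage hg (@subspace_set0 _ M).
move=> /(cspan_min cK sK); apply=> u [B [iB fB sB] Bu].
suff : g @` B `<=` [set 0] by apply; exists u.
apply: (@solvable_subideal_eq0 _ _ (f @` subalgebra_set N) nM).
- exact: image_subideal.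
- rewrite -(sub_valT N) image_comp; exact: (image_ideal hg (J := setT) iB).
- exact: image_finite_dim.
exact: image_solvable.
Qed.

Lemma SemP P L : Sem (subideal_span P) L <-> subideal_span P L `<=` [set 0].
Proof.
split=> [-> //|h]; apply/seteqP; split=> // _ ->.
exact: subspace0 (@subideal_span_subspace P L).
Qed.

Lemma Sem_solvable L :
  Sem (subideal_span (span_solvable_ideals R)) L <-> no_commutative_subideal L.
Proof.
split=> [/SemP h|h]; last first.
  by apply/SemP; exact: (solvable_span_eq0 (@hom_id R L) (image_id _) h).
by apply: centre_Sem_no_commutative => x /centre_span_sub_solvable /h.
Qed.

Lemma Sem_centre L :
  Sem (subideal_span (lie_centre R)) L <-> no_commutative_subideal L.
Proof.
split=> [/SemP|/Sem_solvable/SemP h]; first exact: centre_Sem_no_commutative.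
by apply/SemP => x /centre_span_sub_solvable /h.
Qed.

Lemma no_commutative_subidealP L : no_commutative_subideal L <->
  ~ exists I : set L, [/\ lie_subideal I, commutative_set I, finite_dim I & I <> [set 0]].
Proof.
split=> [h [I [sI cI fI I0]]|h I sI cI fI].
  apply: (ideal_neq0 (subalgebra_ideal (subideal_subalgebra sI)) I0).
  exact: h.
have [-> //|I0] := pselect (I = [set 0]).
by case: h; exists I.
Qed.

End SubidealSpan.

(** * Towers of transfinite iterates *)

Section Tower.
Variables (T : Type) (le : T -> T -> Prop) (next : T -> T) (join : set T -> T).
Hypothesis le_refl : forall x, le x x.
Hypothesis le_trans : forall x y z, le x y -> le y z -> le x z.
Hypothesis le_anti : forall x y, le x y -> le y x -> x = y.
Hypothesis le_next : forall x, le x (next x).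
Hypothesis le_join : forall (C : set T) x, C x -> le x (join C).
Hypothesis join_le : forall (C : set T) y, (forall x, C x -> le x y) -> le (join C) y.

(** The elements reached from [join set0] by transfinite iteration of [next]. *)
Inductive tower : T -> Prop :=
| tower_next x : tower x -> tower (next x)
| tower_join (C : set T) : (forall x, C x -> tower x) -> tower (join C).

Definition tower_lt x y := le x y /\ x <> y.

(** [tower_cut] and [tower_next_le] together show that no element of the tower
    lies strictly between [c] and [next c]; the hypothesis of the first lemma is
    the conclusion of the second. *)
Lemma tower_cut c : (forall y, tower y -> tower_lt y c -> le (next y) c) ->
  forall y, tower y -> le y c \/ le (next c) y.
Proof.
move=> hc y; elim=> [{}y ty [yc|cy]|C tC IH].
- have [->|yc'] := pselect (y = c); first by right.
  by left; exact: hc.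
- by right; exact: le_trans (le_next _).
have [h|/existsNP[x /not_implyP[Cx xc]]] := pselect (forall x, C x -> le x c).
  by left; exact: join_le.
right; have [//|cx] := IH _ Cx.
exact: le_trans cx (le_join Cx).
Qed.

Lemma tower_next_le c : tower c -> forall y, tower y -> tower_lt y c -> le (next y) c.
Proof.
elim=> {c} [c tc IH|C tC IH] y ty [yc ync].
  have [yc'|cy] := tower_cut IH ty; last by case: ync; exact: le_anti.
  have [->//|ync'] := pselect (y = c).
  by apply: le_trans (le_next c); exact: IH.
have [h|/existsNP[z /not_implyP[Cz zy]]] := pselect (forall z, C z -> le z y).
  by case: ync; apply: le_anti => //; exact: join_le.
have [yz|zy'] := tower_cut (IH _ Cz) ty; last first.
  by case: zy; exact: le_trans (le_next _) zy'.
have yz' : y <> z by move=> yz'; apply: zy; rewrite -yz'.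
by apply: le_trans (le_join Cz); exact: IH.
Qed.

Lemma tower_linear x y : tower x -> tower y -> le y x \/ le (next x) y.
Proof. by move=> tx; apply: tower_cut; exact: tower_next_le. Qed.

Lemma tower_total x y : tower x -> tower y -> le x y \/ le y x.
Proof.
move=> tx ty; have [yx|xy] := tower_linear tx ty; [by right|left].
exact: le_trans (le_next _) xy.
Qed.

Lemma tower_fix_top m : next m = m -> tower m -> forall y, tower y -> le y m.
Proof.
move=> mm tm y; elim=> [{}y ty ym|C tC IH]; last exact: join_le.
have [->|ynm] := pselect (y = m); first by rewrite mm.
exact: tower_next_le.
Qed.

(** The join [m] of the lower bounds of [S] in the tower is one of them. If [m]
    were not in [S], then [next m] would be another, and [m] would be fixed by
    [next], hence the top of the tower. *)
Lemma tower_min (S : set T) : (forall x, S x -> tower x) -> S !=set0 ->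
  exists2 m, S m & forall x, S x -> le m x.
Proof.
move=> tS [s0 Ss0]; pose B := [set x | tower x /\ forall s, S s -> le x s].
pose m := join B; have tm : tower m by apply: tower_join => x [].
have mS s : S s -> le m s by move=> Ss; apply: join_le => x [_]; exact.
exists m => //; apply: contrapT => Sm.
have nmB : B (next m).
  split; first exact: tower_next.
  move=> s Ss; apply: tower_next_le => //; first exact: tS.
  by split; [exact: mS|move=> ms; apply: Sm; rewrite ms].
have mm : next m = m by apply: le_anti => //; exact: le_join.
apply: Sm; suff -> : m = s0 by [].
apply: le_anti; first exact: mS.
by apply: tower_fix_top mm tm _ _; exact: tS.
Qed.

(** An element of the tower is either the join of its strict predecessors, or the
    immediate successor of that join. *)
Lemma tower_join_succ (x : T) : tower x ->
  let s := join [set y | tower y /\ tower_lt y x] in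
  s = x \/ [/\ tower s, tower_lt s x & forall z, tower z -> tower_lt s z -> le x z].
Proof.
move=> tx s; have [->|sx] := pselect (s = x); [by left|right].
have ts : tower s by apply: tower_join => y [].
split=> //; first by split=> //; apply: join_le => y [_ []].
move=> z tz [sz snz]; have [//|zx] := tower_total tx tz.
have [->//|znx] := pselect (z = x).
by case: snz; apply: le_anti => //; exact: le_join.
Qed.

End Tower.

(** * Existence of a stable stage *)

Section Star.
Variables (R : realType) (P : ideal_map R).
Arguments P L : clear implicits.
Hypothesis hP : forall M : banachLieType R, closed (P M) /\ lie_ideal (P M).
Variable L : banachLieType R.
Implicit Types (I J : closed_ideal L) (C : set (closed_ideal L)).

Lemma closed_ideal_eq I J : ideal_set I = ideal_set J -> I = J.
Proof.
case: I J => [A cA iA] [B cB iB] /= AB; move: cA iA; rewrite AB => cA iA.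
by congr ClosedIdeal; exact: Prop_irrelevance.
Qed.

Lemma next_stage_closed I : closed (next_stage P I).
Proof. exact: closed_preimage_hom (quotient_map_hom I) _ (hP _).1. Qed.

Lemma next_stage_ideal I : lie_ideal (next_stage P I).
Proof. exact: preimage_ideal (quotient_map_hom I) _ _ (hP _).2. Qed.

(** The next stage after [I], as a closed ideal. *)
Definition next_ideal I := ClosedIdeal (@next_stage_closed I) (next_stage_ideal I).

Lemma join_ideal C : lie_ideal (cspan (\bigcup_(I in C) ideal_set I)).
Proof.
apply: cspan_ideal => x u [I CI Iu]; apply: sub_cspan; exists I => //.
by have [_ _] := idealP I; apply.
Qed.

(** The closed ideal spanned by a family of closed ideals. *)
Definition join_ideals C := ClosedIdeal (@closed_closure _ _) (join_ideal C).

Definition ideal_le I J := ideal_set I `<=` ideal_set J.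

Lemma ideal_le_refl I : ideal_le I I.
Proof. by []. Qed.

Lemma ideal_le_trans I J K : ideal_le I J -> ideal_le J K -> ideal_le I K.
Proof. exact: subset_trans. Qed.

Lemma ideal_le_anti I J : ideal_le I J -> ideal_le J I -> I = J.
Proof. by move=> IJ JI; apply: closed_ideal_eq; exact/seteqP. Qed.

Lemma ideal_le_next I : ideal_le I (next_ideal I).
Proof.
move=> x /quotient_map_eq0 Ix; rewrite /= /next_stage /= Ix.
have [_ [sP _ _]] := hP (quotient_type I); exact: subspace0 sP.
Qed.

Lemma ideal_le_join C I : C I -> ideal_le I (join_ideals C).
Proof. by move=> CI x Ix; apply: sub_cspan; exists I. Qed.

Lemma join_ideal_le C J : (forall I, C I -> ideal_le I J) -> ideal_le (join_ideals C) J.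
Proof.
move=> h; have [sJ _ _] := idealP J.
by apply: cspan_min => [||x [I /h IJ /IJ]//]; first exact: ideal_closed.
Qed.

Local Notation stage := (tower next_ideal join_ideals).

Lemma bottom_stage : stage (join_ideals set0).
Proof. exact: tower_join. Qed.

Lemma bottom_stageE : ideal_set (join_ideals set0) = [set 0].
Proof.
apply/seteqP; split=> [x|_ ->].
  apply: cspan_min => [||u [//]]; [exact: closed_zero|exact: subspace_set0].
by have [s _ _] := idealP (join_ideals set0); exact: subspace0 s.
Qed.

(** For a non-empty chain of ideals the span can be omitted. *)
Lemma join_chain C : C !=set0 ->
  (forall I J, C I -> C J -> ideal_le I J \/ ideal_le J I) ->
  ideal_set (join_ideals C) = closure (\bigcup_(I in C) ideal_set I).
Proof.
move=> [I0 CI0] hC; apply/seteqP; split; last by apply: closureS; exact: sub_lspan.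
apply: closureS; apply: lspan_min => //; apply/subspaceP; split.
  by exists I0 => //; have [s _ _] := idealP I0; exact: subspace0 s.
move=> a x y [I CI Ix] [J CJ Jy].
have [IJ|JI] := hC _ _ CI CJ; [exists J => //|exists I => //].
  have [s _ _] := idealP J; apply: (subspaceD s) => //.
  by apply: (subspaceZ _ s); exact: IJ.
have [s _ _] := idealP I; apply: (subspaceD s); first exact: (subspaceZ _ s).
exact: JI.
Qed.

(** The well-ordered set of stages is the tower itself, ordered by inclusion. *)
Definition stage_type : eqType := {classic {I : closed_ideal L | stage I}}.

Definition stage_ideal (a : stage_type) : closed_ideal L := sval a.

Definition stage_le : rel stage_type :=
  fun a b => `[< ideal_le (stage_ideal a) (stage_ideal b) >].

Lemma stage_inj (a b : stage_type) : stage_ideal a = stage_ideal b -> a = b.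
Proof.
by case: a b => [I sI] [J sJ] /= IJ; move: sI; rewrite IJ => sI; congr exist; exact: Prop_irrelevance.
Qed.

Lemma stage_ltP (a b : stage_type) : wo_lt stage_le a b <->
  tower_lt ideal_le (stage_ideal a) (stage_ideal b).
Proof.
split=> [/andP[ab /asboolP ab']|[ab ab']].
  by split=> // /stage_inj abE; move: ab; rewrite abE eqxx.
by apply/andP; split; [apply/eqP => abE; apply: ab'; rewrite abE|exact/asboolP].
Qed.

Let stage_min := tower_min ideal_le_refl ideal_le_trans ideal_le_anti
  ideal_le_next ideal_le_join join_ideal_le.
Let stage_next_le := tower_next_le ideal_le_refl ideal_le_trans ideal_le_anti
  ideal_le_next ideal_le_join join_ideal_le.
Let stage_total := tower_total ideal_le_refl ideal_le_trans ideal_le_anti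
  ideal_le_next ideal_le_join join_ideal_le.
Let stage_fix_top := tower_fix_top ideal_le_refl ideal_le_trans ideal_le_anti
  ideal_le_next ideal_le_join join_ideal_le.
Let stage_join_succ := tower_join_succ ideal_le_refl ideal_le_trans ideal_le_anti
  ideal_le_next ideal_le_join join_ideal_le.

Lemma stage_well_order : wochoice.well_order stage_le.
Proof.
apply: wochoice.antisymmetric_well_order.
  move=> a b /andP[/asboolP ab /asboolP ba].
  by apply: stage_inj; exact: ideal_le_anti.
move=> A [a0 Aa0].
have [||I [a Aa aI] hI] := stage_min (S := [set stage_ideal a | a in [set a | a \in A]]).
- by move=> _ [a _ <-]; exact: (svalP a).
- by exists (stage_ideal a0); exists a0.
exists a; split=> // b Ab; apply/asboolP; rewrite aI; apply: hI.
by exists b.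
Qed.

Lemma stage_chain : transfinite_chain stage_le P stage_ideal.
Proof.
split; first exact: stage_well_order.
- move=> a /(_ (exist _ _ bottom_stage))/asboolP /= ha.
  apply/seteqP; split=> [x /ha|_ ->]; first by rewrite bottom_stageE.
  by have [s _ _] := idealP (stage_ideal a); exact: subspace0 s.
- move=> a b [/stage_ltP ab hb].
  pose c : stage_type := exist _ _ (tower_next (svalP a)).
  suff -> : b = c by [].
  apply: stage_inj; apply: ideal_le_anti; last first.
    by apply: stage_next_le => //; [exact: (svalP b)|exact: (svalP a)].
  apply/asboolP; apply: hb; apply/stage_ltP; split; first exact: ideal_le_next.
  move=> ac; case: ab => ab; apply; apply: ideal_le_anti => //.
  by apply: stage_fix_top (esym ac) (svalP a) _ (svalP b).
move=> a [nl ns]; pose C := [set I | stage I /\ tower_lt ideal_le I (stage_ideal a)].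
have -> : \bigcup_(b in [set b | wo_lt stage_le b a]) ideal_set (stage_ideal b) =
    \bigcup_(I in C) ideal_set I.
  apply/seteqP; split=> [x [b /stage_ltP ba bx]|x [I [sI Ia] Ix]].
    by exists (stage_ideal b) => //; split=> //; exact: (svalP b).
  by exists (exist _ I sI) => //; exact/stage_ltP.
rewrite -join_chain.
- (* Were the join of the predecessors of [a] not [a] itself, [a] would be its
     successor. *)
  have sa : stage (stage_ideal a) := svalP a.
  have /= [sE|[sC Ca hC]] := stage_join_succ sa; first by rewrite -[X in ideal_set X = _]sE.
  case: ns; exists (exist _ _ sC); split; first exact/stage_ltP.
  by move=> c /stage_ltP ac; apply/asboolP; apply: hC => //; exact: (svalP c).
- apply: contrapT => C0; apply: nl => b; apply/asboolP.
  have [//|ba] := stage_total (svalP a) (svalP b).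
  have [abE|ab] := pselect (stage_ideal b = stage_ideal a).
    by rewrite abE; exact: ideal_le_refl.
  by case: C0; exists (stage_ideal b); split=> //; exact: (svalP b).
by move=> I J [sI _] [sJ _]; exact: stage_total.
Qed.

(** The join of the whole tower is its largest element, hence a fixed point. *)
Lemma stable_value_exists : exists I, stable_value P I.
Proof.
pose I := join_ideals [set I | stage I].
have sI : stage I by apply: tower_join.
exists I; split.
  by exists stage_type, stage_le, stage_ideal, (exist _ I sI); split=> //; exact: stage_chain.
apply/seteqP; split; last exact: ideal_le_next.
by apply: (@ideal_le_join [set I | stage I] (next_ideal I)); exact: tower_next.
Qed.

End Star.

(** * The stable stage as a least ideal *)

Section QuotientFactor.
Variables (R : realType) (L : banachLieType R) (I J : closed_ideal L).
Hypothesis IJ : ideal_set I `<=` ideal_set J.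

(** The map [L / I -> L / J] induced by [I `<=` J]. *)
Definition quotient_factor (u : quotient_type I) : quotient_type J :=
  quotient_map J (quotient_repr u).

Lemma quotient_factorE x : quotient_factor (quotient_map I x) = quotient_map J x.
Proof. by apply/quotient_mapP; apply: IJ; apply/quotient_mapP; rewrite quotient_reprK. Qed.

Lemma quotient_factor_le u : `|quotient_factor u| <= `|u|.
Proof.
have rE (V : normedModType R[i]) (v : V) : `|v| = (complex.Re `|v|)%:C.
  by rewrite RRe_real// normr_real.
(* The quotient norm is an infimum over the representatives of [u]. *)
have -> : `|u| = quotient_norm u by [].
rewrite rE lecR; apply: lb_le_inf.
  exists (complex.Re `|quotient_repr u|), (quotient_repr u) => //.
  exact: quotient_reprK.
move=> _ [x /= <- <-]; rewrite -lecR -!rE quotient_factorE.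
exact: quotient_map_norm.
Qed.

Lemma quotient_factor_hom : bounded_hom quotient_factor.
Proof.
split=> [a u v|u v|]; last by exists 1 => u; rewrite mul1r; exact: quotient_factor_le.
- rewrite -(quotient_reprK u) -(quotient_reprK v) -quotient_mapZ -quotient_mapD.
  by rewrite !quotient_factorE quotient_mapD quotient_mapZ.
rewrite -(quotient_reprK u) -(quotient_reprK v) -quotient_map_lie.
by rewrite !quotient_factorE quotient_map_lie.
Qed.

Lemma quotient_factorT : range quotient_factor = setT.
Proof.
apply/seteqP; split=> // u _; exists (quotient_map I (quotient_repr u)) => //.
by rewrite quotient_factorE quotient_reprK.
Qed.

End QuotientFactor.

Section StarLeast.
Variables (R : realType) (P : ideal_map R).
Arguments P L : clear implicits.
Hypothesis hP : forall M : banachLieType R, closed (P M) /\ lie_ideal (P M).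
Hypothesis centre_P : forall M, subideal_span (lie_centre R) M `<=` P M.
Hypothesis P_solvable : forall M, P M `<=` subideal_span (span_solvable_ideals R) M.
Variable L : banachLieType R.
Implicit Types I J : closed_ideal L.

Lemma next_stage_sub I J : ideal_set I `<=` ideal_set J ->
  no_commutative_subideal (quotient_type J) -> next_stage P I `<=` ideal_set J.
Proof.
move=> IJ nJ x /P_solvable Px; apply/quotient_map_eq0.
have := solvable_span_eq0 (quotient_factor_hom IJ) (quotient_factorT IJ) nJ Px.
by rewrite /= quotient_factorE.
Qed.

(** Transfinite induction along the chain. *)
Lemma chain_sub J (A : eqType) (le : rel A) (f : A -> closed_ideal L) :
  no_commutative_subideal (quotient_type J) -> transfinite_chain le P f ->
  forall a, ideal_set (f a) `<=` ideal_set J.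
Proof.
move=> nJ [wo f0 fS flim] a; apply: contrapT => naJ.
have anti : antisymmetric le.
  move=> b c; apply: (@wochoice.wo_chain_antisymmetric _ _ predT) => //.
  exact: wochoice.withinW.
have [|b [[bJ bmin] _]] := wo [pred a | ~~ `[< ideal_set (f a) `<=` ideal_set J >]].
  by exists a; rewrite inE; apply/asboolPn.
have lt_sub c : wo_lt le c b -> ideal_set (f c) `<=` ideal_set J.
  move=> /andP[cb lecb]; apply: contrapT => cJ; move/eqP: cb; apply.
  by apply: anti; rewrite lecb; apply: bmin; rewrite inE; apply/asboolPn.
move: bJ; rewrite inE => /asboolPn; apply.
have [/f0 ->|nl] := pselect (wo_least le b).
  by have [sJ _ _] := idealP J => _ ->; exact: subspace0 sJ.
have [[c cb]|ns] := pselect (exists c, wo_succ le c b).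
  by rewrite (fS _ _ cb); apply: next_stage_sub => //; apply: lt_sub; case: cb.
rewrite flim//; apply: closure_subset_closed; first exact: ideal_closed.
by move=> x [c /lt_sub cJ /cJ].
Qed.

Lemma stable_no_commutative I : next_stage P I = ideal_set I ->
  no_commutative_subideal (quotient_type I).
Proof.
move=> nI; apply: centre_Sem_no_commutative => u /centre_P Pu.
rewrite -(quotient_reprK u); apply/quotient_map_eq0; rewrite -nI.
by rewrite /next_stage /= quotient_reprK.
Qed.

(** The stable value depends only on the class of algebras on which [P]
    vanishes. *)
Lemma star_least : exists I, [/\ star P L = ideal_set I,
  no_commutative_subideal (quotient_type I) &
  forall J, no_commutative_subideal (quotient_type J) -> ideal_set I `<=` ideal_set J].
Proof.
have [I sI] := stable_value_exists hP L; exists I.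
have least J K : stable_value P J -> no_commutative_subideal (quotient_type K) ->
    ideal_set J `<=` ideal_set K.
  by move=> [[A [le [f [a [hf <-]]]]] _] nK; exact: chain_sub nK hf a.
have nI := stable_no_commutative sI.2; split=> // [|J]; last exact: least.
apply/seteqP; split=> [x [J sJ Jx]|x Ix]; last by exists I.
exact: least sJ nI _ Jx.
Qed.

End StarLeast.

Section StarEquality.
Variable R : realType.

Lemma star_solvable_least (L : banachLieType R) :
  exists I : closed_ideal L,
  [/\ star (subideal_span (span_solvable_ideals R)) L = ideal_set I,
  no_commutative_subideal (quotient_type I) &
  forall J : closed_ideal L, no_commutative_subideal (quotient_type J) ->
    ideal_set I `<=` ideal_set J].
Proof.
apply: star_least => [M|M|M].
- split; first exact: subideal_span_closed.
  by apply: subideal_span_ideal; exact: solvable_surjection_stable.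
- exact: centre_span_sub_solvable.
- exact: subset_refl.
Qed.

Lemma star_centre_least (L : banachLieType R) :
  exists I : closed_ideal L,
  [/\ star (subideal_span (lie_centre R)) L = ideal_set I,
  no_commutative_subideal (quotient_type I) &
  forall J : closed_ideal L, no_commutative_subideal (quotient_type J) ->
    ideal_set I `<=` ideal_set J].
Proof.
apply: star_least => [M|M|M].
- split; first exact: subideal_span_closed.
  by apply: subideal_span_ideal; exact: centre_surjection_stable.
- exact: subset_refl.
- exact: centre_span_sub_solvable.
Qed.

Lemma abelian_span_centreE :
  subideal_span (span_abelian_ideals R) = subideal_span (lie_centre R).
Proof. by apply: functional_extensionality_dep => L; exact: abelian_span_centre. Qed.

Lemma star_solvable_centre (L : banachLieType R) :
  star (subideal_span (span_solvable_ideals R)) L =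
  star (subideal_span (lie_centre R)) L.
Proof.
have [I [-> nI hI]] := star_solvable_least L.
have [J [-> nJ hJ]] := star_centre_least L.
by apply/seteqP; split; [exact: hI|exact: hJ].
Qed.

End StarEquality.

(** * Radicals in finite dimension *)

Section FiniteDimension.
Variables (R : realType) (L : banachLieType R).
Implicit Types (A I J N : set L) (s t : seq L).

Lemma lspan_cons x s : lspan [set` x :: s] `<=`
  [set a *: x + y | a in [set: R[i]] & y in lspan [set` s]].
Proof.
apply: lspan_min => [|y].
  have -> : [set a *: x + y | a in [set: R[i]] & y in lspan [set` s]] =
      [set u + y | u in range ( *:%R^~ x : R[i] -> L) & y in lspan [set` s]].
    apply/seteqP; split=> [_ [a _ [y ys <-]]|_ [_ [a _ <-] [y ys <-]]].
      by exists (a *: x); [exists a|exists y].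
    by exists a => //; exists y.
  by apply: subspace_sum; [exact: line_subspace|exact: lspan_subspace].
rewrite /= inE => /predU1P[->|ys].
  exists 1 => //; exists 0; last by rewrite scale1r addr0.
  exact: subspace0 (lspan_subspace _).
by exists 0 => //; exists y; [exact: sub_lspan|rewrite scale0r add0r].
Qed.

(** A subspace of a finitely generated space is generated by finitely many of its
    own elements. *)
Lemma finite_dim_basis A : subspace_set A -> finite_dim A ->
  exists t, [set` t] `<=` A /\ A `<=` lspan [set` t].
Proof.
move=> sA [s]; elim: s A sA => [|x s IHs] A sA As.
  by exists [::]; split => // y; rewrite /= in_nil.
pose B := A `&` lspan [set` s].
have sB : subspace_set B.
  have /subspaceP[A0 AD] := sA.
  have /subspaceP[S0 SD] := lspan_subspace [set` s].
  by apply/subspaceP; split=> // a u v [Au su] [Av sv]; split; [exact: AD|exact: SD].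
have [t [tB Bt]] := IHs B sB (@subIsetr _ _ _).
have [AS|/existsNP[v /not_implyP[Av nv]]] := pselect (A `<=` lspan [set` s]).
  by exists t; split=> [y /tB[]//|y Ay]; apply: Bt; split=> //; exact: AS.
have [c _ [w ws cwv]] := lspan_cons (As _ Av).
have c0 : c != 0.
  by apply/eqP => c0; apply: nv; rewrite -cwv c0 scale0r add0r.
exists (v :: t); split=> [y|u Au].
  by rewrite /= inE => /predU1P[->//|/tB[]].
have [d _ [w' ws' dwu]] := lspan_cons (As _ Au).
have sS := lspan_subspace [set` v :: t].
rewrite -(subrK ((d / c) *: v) u); apply: (subspaceD sS); last first.
  by apply: (subspaceZ _ sS); apply: sub_lspan; rewrite /= inE eqxx.
suff /Bt : B (u - (d / c) *: v).
  by apply: lspanS => y /= yt; rewrite inE yt orbT.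
split; first by apply: (subspaceB sA) => //; exact: (subspaceZ _ sA).
rewrite -dwu -cwv scalerDr scalerA divfK// opprD addrACA subrr add0r.
apply: (subspaceB (lspan_subspace _)) => //.
exact: (subspaceZ _ (lspan_subspace _)).
Qed.

(** [I] is the radical of the subalgebra [J]. *)
Definition largest_solvable_ideal J I := [/\ lie_ideal_of I J, solvable_set I &
  forall B, lie_ideal_of B J -> solvable_set B -> B `<=` I].

(** Sums of solvable ideals are solvable, so the union [F] of the solvable ideals
    is a subspace; the finitely many generators of [F] lie in one of them. *)
Lemma largest_solvable_ideal_exists J : finite_dim [set: L] -> lie_subalgebra J ->
  exists I, largest_solvable_ideal J I.
Proof.
move=> fL sJ; have [sbJ _] := sJ.
pose F := [set x | exists I, [/\ lie_ideal_of I J, solvable_set I & I x]].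
have zeroI : lie_ideal_of [set 0] J.
  split; [exact: subspace_set0|by move=> _ ->; exact: subspace0|].
  by move=> x _ _ ->; rewrite lie0r.
have szero : solvable_set [set (0 : L)] by exists 0%N.
have sF : subspace_set F.
  apply/subspaceP; split; first by exists [set 0].
  move=> a x y [I [iI sI Ix]] [I' [iI' sI' Iy]].
  exists [set u + v | u in I & v in I']; split.
  - exact: sum_ideal.
  - exact: sum_solvable iI iI' sI sI'.
  by exists (a *: x); [apply: subspaceZ => //; case: iI|exists y].
have [t [tF Ft]] := finite_dim_basis sF (finite_dimS (@subsetT _ _) fL).
have [I [iI sI tI]] : exists I, [/\ lie_ideal_of I J, solvable_set I & [set` t] `<=` I].
  elim: t {Ft} tF => [|x t IHt] tF.
    by exists [set 0]; split=> // y; rewrite /= in_nil.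
  have [|I [iI sI tI]] := IHt.
    by move=> y yt; apply: tF; rewrite /= inE yt orbT.
  have [|I' [iI' sI' Ix]] := tF x; first by rewrite /= inE eqxx.
  exists [set u + v | u in I & v in I']; split.
  - exact: sum_ideal.
  - exact: sum_solvable iI iI' sI sI'.
  have [zI _ _] := iI; have [zI' _ _] := iI'.
  move=> y; rewrite /= inE => /predU1P[->|/tI Iy].
    by exists 0; [exact: subspace0|exists x; rewrite ?add0r].
  by exists y => //; exists 0; [exact: subspace0|rewrite addr0].
exists I; split=> // B iB sB x Bx.
have Fx : F x by exists B.
by apply: (lspan_min _ tI) (Ft _ Fx); case: iI.
Qed.

(** The closure of a solvable ideal of [J] is another one. *)
Lemma largest_solvable_closed J I : closed J -> largest_solvable_ideal J I -> closed I.
Proof.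
move=> cJ [iI sI hI] x; apply: hI; last exact: closure_solvable.
by have := closure_ideal iI; rewrite -((closure_id J).1 cJ).
Qed.

(** The radical of a closed ideal is invariant under [exp (ad y)], hence under
    [ad y]. *)
Lemma largest_solvable_ideal_of J K I : closed J -> lie_ideal_of J K ->
  largest_solvable_ideal J I -> lie_ideal_of I K.
Proof.
move=> cJ JK lI; have cI := largest_solvable_closed cJ lI.
have [iI sI hI] := lI; have [sbI IsJ _] := iI; have [sbJ JsK hJ] := JK.
split=> //; first exact: subset_trans JsK.
move=> y x Ky; apply: (exp_ad_derive cI sbI) => a cy u Iu.
have adJ (b : R[i]) v : J v -> J (lie (b *: y) v).
  by move=> Jv; rewrite lieZl; apply: (subspaceZ _ sbJ); exact: hJ.
have EJ : exp_ad (a *: y) @` J = J.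
  apply/seteqP; split=> [_ [v Jv <-]|v Jv].
    by apply: exp_ad_stable => // w; exact: adJ.
  exists (exp_ad (- (a *: y)) v); last exact: exp_adK.
  apply: exp_ad_stable => //; first exact: ad_contractionN.
  by move=> w; rewrite -scaleNr; exact: adJ.
have hE := exp_ad_hom cy.
apply: (hI (exp_ad (a *: y) @` I)); last by exists u.
  by rewrite -[X in lie_ideal_of _ X]EJ; exact: image_ideal.
exact: image_solvable.
Qed.

(** Closures of the terms of a chain of subideals form another chain, to which
    the invariance of radicals applies step by step. *)
Lemma solvable_subideal_sub_ideal N : finite_dim [set: L] -> lie_subideal N ->
  solvable_set N -> exists I, [/\ lie_ideal I, solvable_set I & N `<=` I].
Proof.
move=> fL [n [J [J0 Jn sJ hJ]]] sN.
suff h i : (i <= n)%N -> exists I, [/\ lie_ideal_of I (closure (J i)),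
    solvable_set I & N `<=` I].
  by have := h n (leqnn _); rewrite Jn closureT.
elim: i => [|i IHi] ni.
  exists (closure N); split; last exact: subset_closure.
    rewrite J0; apply: subalgebra_ideal; apply: closure_subalgebra.
    by rewrite -J0; exact: sJ.
  exact: closure_solvable.
have [I' [iI' sI' NI']] := IHi (ltnW ni).
have sJi : lie_subalgebra (closure (J i)) by apply: closure_subalgebra; exact: sJ (ltnW ni).
have [I lI] := largest_solvable_ideal_exists fL sJi.
have [iI sI hI] := lI; exists I; split=> //.
  apply: largest_solvable_ideal_of lI; first exact: closed_closure.
  exact: closure_ideal (hJ _ ni).
by move=> x /NI'; exact: hI.
Qed.

End FiniteDimension.

Section Radical.
Variables (R : realType) (L : banachLieType R).

Lemma finite_dim_radical_least (I : closed_ideal L) : finite_dim [set: L] ->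
  no_commutative_subideal (quotient_type I) ->
  (forall J : closed_ideal L, no_commutative_subideal (quotient_type J) ->
    ideal_set I `<=` ideal_set J) ->
  is_radical (ideal_set I).
Proof.
move=> fL nI leastI.
have sT : lie_subalgebra [set: L] by split=> //; exact: subspaceT.
have [r lr] := largest_solvable_ideal_exists fL sT; have [ir sr hr] := lr.
have cr : closed r := largest_solvable_closed (@closedT _) lr.
pose r' := ClosedIdeal cr ir; pose q := quotient_map r'.
have hq : bounded_hom q := quotient_map_hom r'.
have fM : finite_dim [set: quotient_type r'].
  by rewrite -(quotient_mapT r'); exact: image_finite_dim hq _ fL.
suff Ir : ideal_set I = r by rewrite Ir; split.
apply/seteqP; split.
  apply: (leastI r') => B sB cB _ u Bu.
  have [K [iK sK BK]] := solvable_subideal_sub_ideal fM sB (commutative_solvable cB).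
  rewrite -(quotient_reprK u); apply/quotient_map_eq0 => /=.
  apply: (hr (q @^-1` K)).
  - exact: preimage_ideal hq _ _ iK.
  - by apply: preimage_solvable => //; rewrite /q quotient_map_ker.
  by rewrite /q /= quotient_reprK; exact: BK.
have hqI := quotient_map_hom I; have qIT := quotient_mapT I.
move=> x rx; apply/quotient_map_eq0.
apply: (@solvable_subideal_eq0 _ _ (quotient_map I @` r) setT nI).
- by apply: ideal_subideal; split=> //; exact: subspaceT.
- exact: image_lie_ideal hqI qIT _ ir.
- by apply: image_finite_dim => //; exact: finite_dimS fL.
- exact: image_solvable.
by exists x.
Qed.

End Radical.

(** * The centre *)

Section Centre.
Variable R : realType.

Lemma lie_centre_closed (L : banachLieType R) : closed (lie_centre R L).
Proof.
move=> x cx y; apply: closure_set0.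
by apply: (closure_lie _ cx (@subset_closure _ [set y] y erefl)) => u _ + ->; exact.
Qed.

Lemma lie_centre_ideal (L : banachLieType R) : lie_ideal (lie_centre R L).
Proof.
split=> //.
  apply/subspaceP; split=> [y|a x y cx cy z]; first exact: lie0l.
  by rewrite lieDl lieZl cx cy scaler0 addr0.
by move=> x y _ cy z; rewrite (lieC x) cy oppr0 lie0l.
Qed.

(** The centralizer of [f x] is closed and contains the dense range of [f]. *)
Lemma lie_centre_preradical : preradical (lie_centre R).
Proof.
split=> [L|L M f [flie fC] fD _ [x cx <-] y].
  by split; [exact: lie_centre_closed|exact: lie_centre_ideal].
have hf : bounded_hom f by split=> // a u v; exact: linearP.
apply: contrapT => xy; pose A := lie (f x) @^-1` [set (0 : M)].
have cA : closed A := ad_preimage_closed (@closed_zero _ M).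
have [||w [Aw [v _ fv]]] := fD (~` A); first by exists y.
  exact: closed_openC.
by apply: Aw; rewrite -fv /A /= -flie cx (hom0 hf).
Qed.

Lemma lie_centre_lower_stable : lower_stable (lie_centre R).
Proof.
move=> L I IE; apply/centre_setT => x y.
by rewrite IE => cx _; exact: cx.
Qed.

End Centre.

Theorem theorem6p21 (R : realType) :
  [/\ (forall L : banachLieType R,
         (Sem (subideal_span (span_solvable_ideals R)) L <->
          Sem (subideal_span (span_abelian_ideals R)) L) /\
         (Sem (subideal_span (span_abelian_ideals R)) L <->
          ~ exists I : set L, [/\ lie_subideal I, commutative_set I,
                                  finite_dim I & I <> [set 0]])),
      [/\ preradical (lie_centre R),
          lower_stable (lie_centre R)
        & forall L : banachLieType R,
            star (subideal_span (span_solvable_ideals R)) L =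
              star (subideal_span (span_abelian_ideals R)) L /\
            star (subideal_span (span_abelian_ideals R)) L =
              star (subideal_span (lie_centre R)) L]
    & forall L : banachLieType R, finite_dim [set: L] ->
        is_radical (star (subideal_span (span_abelian_ideals R)) L)].
Proof.
rewrite (abelian_span_centreE R); split=> [L||L fL].
- have SC := Sem_centre L; have SS := Sem_solvable L.
  have NC := no_commutative_subidealP L.
  by split; [rewrite SS SC|rewrite SC].
- split; [exact: lie_centre_preradical|exact: lie_centre_lower_stable|].
  by move=> L; split=> //; exact: star_solvable_centre.
have [I [-> nI hI]] := star_centre_least L.
exact: finite_dim_radical_least.
Qed.
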